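(* Let $n \geq 1$. If $K \subset \mathbb{R}^n$ is compact then $$m_n(K) = |\mathbb{S}^{n-1}| \lim_{p \nearrow n} \frac{\operatorname{Cap}_p(K)^p}{n-p}.$$
   Context: For compact $K \subset \mathbb{R}^n$ and $p>0$, the Riesz $p$-energy is $V_p(K) = \min_\mu \int_K \int_K |x-y|^{-p} \, d\mu(x) \, d\mu(y)$, where the minimum is over all probability measures (positive unit Borel measures) $\mu$ on $K$, the kernel is $+\infty$ when $x=y$, and the value lies in $(0,+\infty]$; by convention $V_p(\emptyset)=+\infty$. The Riesz $p$-capacity is $\operatorname{Cap}_p(K) = V_p(K)^{-1/p}$, with the convention $(+\infty)^{-1/p}=0$. $m_n$ denotes Lebesgue measure on $\mathbb{R}^n$, and $|\mathbb{S}^{n-1}|$ is the $(n-1)$-dimensional surface measure of the unit sphere in $\mathbb{R}^n$ (so $|\mathbb{S}^0|=2$). *)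

(* Defs.v *)
From HB Require Import structures.
From mathcomp Require Import all_boot all_order all_algebra.
From mathcomp Require Import all_classical all_reals all_analysis.
From mathcomp Require Import measurable_realfun.

Set Implicit Arguments.
Unset Strict Implicit.
Unset Printing Implicit Defensive.

Import Order.TTheory GRing.Theory Num.Theory.
Import numFieldNormedType.Exports.

Local Open Scope classical_set_scope.
Local Open Scope ring_scope.

Notation borel_rV R n := (g_sigma_algebraType (@open 'rV[R]_n)).

Section euclidean_measurability.
Context {R : realType}.

Lemma rV_open_rat_box n (U : set 'rV[R]_n) (x : 'rV[R]_n) : open U -> U x ->
  exists q : 'rV[rat]_n * rat,
    (forall i, `|x 0 i - ratr (q.1 0 i)| < ratr q.2) /\
    [set v : 'rV[R]_n | forall i, `|v 0 i - ratr (q.1 0 i)| < ratr q.2] `<=` U.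
Proof.
move=> oU Ux.
have /nbhs_ballP[e /= e0 eU] : nbhs x U by exact: open_nbhs_nbhs.
have e20 : 0 < e / 2 by rewrite divr_gt0.
have [r] := rat_in_itvoo e20; rewrite in_itv/= => /andP[r0 re].
have H i : exists c : rat, `|x 0 i - ratr c| < ratr r.
  have xr : x 0 i - ratr r < x 0 i + ratr r by rewrite ltrD2l gtrN.
  have [c] := rat_in_itvoo xr; rewrite in_itv/= => /andP[c1 c2].
  by exists c; rewrite distrC ltr_distl c1 c2.
have [c Hc] := choice H.
exists (\row_i c i, r); split => /= [i|v /= vr]; first by rewrite mxE.
apply: eU; split => // i j; rewrite (ord1 i) /ball/=.
rewrite -(subrKA (ratr (c j))) (le_lt_trans (ler_normD _ _))// (splitr e) ltrD//.
  exact: lt_trans re.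
by rewrite distrC; apply: lt_trans re; have := vr j; rewrite mxE.
Qed.

Lemma measurable_fun_rV d (T : measurableType d) n (f : T -> borel_rV R n) :
  (forall i, measurable_fun setT (fun t => (f t : 'rV[R]_n) 0 i)) ->
  measurable_fun setT f.
Proof.
move=> mf; apply: (@measurability _ _ T (borel_rV R n) setT f (@open 'rV[R]_n)) => //.
move=> _ [U oU <-]; rewrite setTI.
pose B (q : 'rV[rat]_n * rat) : set 'rV[R]_n :=
  [set v | forall i, `|v 0 i - ratr (q.1 0 i)| < ratr q.2].
pose F k : set T := if unpickle k is Some q then
  (if `[< B q `<=` U >] then f @^-1` B q else set0) else set0.
have -> : f @^-1` U = \bigcup_k F k.
  apply/seteqP; split => [t /= Uft|t [k _]].
    have [q [qx qU]] := rV_open_rat_box oU Uft.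
    exists (pickle q) => //; rewrite /F pickleK.
    by case: asboolP => // /(_ qU).
  by rewrite /F; case: unpickle => // q; case: asboolP => // qU /qU.
apply: bigcupT_measurable => k; rewrite /F.
case: unpickle => // q; case: asboolP => // _.
have -> : f @^-1` B q = \bigcap_(i in [set: 'I_n])
    ((fun t => (f t : 'rV[R]_n) 0 i) @^-1`
      ball (ratr (q.1 0 i) : R) (ratr q.2)).
  apply/seteqP; split => t /= H i; first by move=> _; rewrite /= /ball/= distrC.
  by have := H i I; rewrite /= /ball/= distrC.
apply: fin_bigcap_measurable => // i _; rewrite -[X in measurable X]setTI.
by apply: mf => //; apply: open_measurable; exact: ball_open.
Qed.

Lemma measurable_coord_rV n (i : 'I_n) :
  measurable_fun setT (fun v : borel_rV R n => (v : 'rV[R]_n) 0 i).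
Proof.
apply: (measurability _ (RGenOpens.measurableE R)) => _ [_ [a [b ->] <-]].
rewrite setTI; apply: sub_sigma_algebra.
have /continuousP := @coord_continuous R 1 n 0 i; apply; exact: interval_open.
Qed.

End euclidean_measurability.

Section lebesgue_rV.
Context {R : realType}.

Definition rV_cons n (xv : measurableTypeR R * borel_rV R n) : borel_rV R n.+1 :=
  \row_i oapp (fun j => (xv.2 : 'rV[R]_n) 0 j) xv.1 (unlift 0 i).

Let rV_uncons n (w : borel_rV R n.+1) : measurableTypeR R * borel_rV R n :=
  ((w : 'rV[R]_n.+1) 0 0, \row_j (w : 'rV[R]_n.+1) 0 (lift 0 j)).

Let rV_consK n : cancel (@rV_cons n) (@rV_uncons n).
Proof.
move=> [x v]; rewrite /rV_uncons /rV_cons !mxE unlift_none/=; congr (_, _).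
by apply/rowP => j; rewrite !mxE liftK.
Qed.

Let measurable_rV_cons n :
  measurable_fun setT (@rV_cons n).
Proof.
apply: measurable_fun_rV => i; case: (unliftP 0 i) => [j ->|->].
  under eq_fun do rewrite mxE liftK/=.
  apply: (measurableT_comp (@measurable_coord_rV R n j)) => //.
under eq_fun do rewrite mxE unlift_none/=.
exact: measurable_fst.
Qed.

Let measurable_rV_uncons n :
  measurable_fun setT (@rV_uncons n).
Proof.
apply: measurable_fun_pair; first exact: measurable_coord_rV.
apply: measurable_fun_rV => j; under eq_fun do rewrite mxE.
exact: measurable_coord_rV.
Qed.

Section step.
Variables (n : nat) (mu : {sigma_finite_measure set (borel_rV R n) -> \bar R}).

(* Lebesgue measure on R^(n+1) is the product of the one on R and the one on R^n,
   transported along the identification [rV_cons]. *)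
Definition lebesgue_rV_step : set (borel_rV R n.+1) -> \bar R :=
  pushforward (@lebesgue_measure R \x mu)%E
    (@rV_cons n).

Let step0 : lebesgue_rV_step set0 = 0%E.
Proof. by rewrite /lebesgue_rV_step /pushforward preimage_set0 measure0. Qed.

Let step_ge0 A : (0 <= lebesgue_rV_step A)%E.
Proof. exact: measure_ge0. Qed.

Let step_sigma_additive : semi_sigma_additive lebesgue_rV_step.
Proof.
move=> F mF tF mUF.
rewrite /lebesgue_rV_step /pushforward preimage_bigcup.
have mpre (A : set (borel_rV R n.+1)) : measurable A -> measurable (@rV_cons n @^-1` A :
    set (measurableTypeR R * borel_rV R n)%type).
  by move=> mA; rewrite -[X in measurable X]setTI; exact: measurable_rV_cons.
apply: measure_semi_sigma_additive => [k||]; first exact: mpre.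
- apply/trivIsetP => /= i j _ _ ij; rewrite -preimage_setI.
  by move/trivIsetP : tF => /(_ _ _ _ _ ij) ->//; rewrite preimage_set0.
- by rewrite -preimage_bigcup; exact: mpre.
Qed.

HB.instance Definition _ := isMeasure.Build _ _ _ lebesgue_rV_step
  step0 step_ge0 step_sigma_additive.

Let step_sigma_finite : sigma_finite setT lebesgue_rV_step.
Proof.
have /sigma_finiteP[F [TF ndF Foo]] := sigma_finiteT (@lebesgue_measure R).
have /sigma_finiteP[G [TG ndG Goo]] := sigma_finiteT mu.
exists (fun k => @rV_uncons n @^-1` (F k `*` G k)).
  rewrite -preimage_bigcup -[LHS](@preimage_setT _ _ (@rV_uncons n)).
  congr (_ @^-1` _); rewrite -setXTT TF TG predeqE => -[x y]; split.
    move=> [/= [k _ Fkx] [l _ Gly]]; exists (maxn k l) => //; split.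
    - by move: x Fkx; exact/subsetPset/ndF/leq_maxl.
    - by move: y Gly; exact/subsetPset/ndG/leq_maxr.
  by move=> [k _ []/= ? ?]; split; exists k.
move=> k; have [mF Fk] := Foo k; have [mG Gk] := Goo k; split.
  by rewrite -[X in measurable X]setTI; apply: measurable_rV_uncons => //;
    exact: measurableX.
rewrite /lebesgue_rV_step /pushforward.
have -> : @rV_cons n @^-1` (@rV_uncons n @^-1` (F k `*` G k)) = F k `*` G k.
  rewrite -comp_preimage (_ : _ \o _ = id) ?preimage_id//.
  by apply/funext => z; exact: rV_consK.
by rewrite product_measure1E// lte_mul_pinfty// ge0_fin_numE.
Qed.

HB.instance Definition _ := Measure_isSigmaFinite.Build _ _ _ lebesgue_rV_step
  step_sigma_finite.

End step.

Fixpoint lebesgue_rV n : {sigma_finite_measure set (borel_rV R n) -> \bar R} :=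
  if n is n'.+1 then lebesgue_rV_step (lebesgue_rV n') else @dirac _ (borel_rV R 0) (0 : 'rV[R]_0) R.

Lemma lebesgue_rV0 : lebesgue_rV 0 = \d_(0 : borel_rV R 0) :> (set _ -> \bar R).
Proof. by []. Qed.

Lemma lebesgue_rVS n : lebesgue_rV n.+1 =
  pushforward (@lebesgue_measure R \x lebesgue_rV n)%E (@rV_cons n)
  :> (set (borel_rV R n.+1) -> \bar R).
Proof. by []. Qed.

Lemma lebesgue_rV_box n (A : 'I_n -> set R) :
  (forall i, measurable (A i : set (measurableTypeR R))) ->
  lebesgue_rV n [set v : 'rV[R]_n | forall i, A i (v 0 i)] =
  (\prod_(i < n) lebesgue_measure (A i))%E.
Proof.
elim: n A => [|n ih] A mA.
  rewrite big_ord0 lebesgue_rV0 (_ : [set _ | _] = setT) ?diracT//.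
  by apply/seteqP; split => // v _ [].
rewrite big_ord_recl -ih//.
have mB : measurable ([set v : 'rV[R]_n | forall i, A (lift 0 i) (v 0 i)] :
    set (borel_rV R n)).
  rewrite (_ : mkset _ = \bigcap_(i in [set: 'I_n])
    (fun v : borel_rV R n => (v : 'rV[R]_n) 0 i) @^-1` A (lift 0 i)); last first.
    by apply/seteqP; split => [v /= H i _|v /= H i]; [exact: H|exact: (H i I)].
  apply: fin_bigcap_measurable => // i _.
  by rewrite -[X in measurable X]setTI; apply: measurable_coord_rV => //; exact: mA.
rewrite -product_measure1E// lebesgue_rVS /pushforward; congr (product_measure1 _ _ _).
apply/seteqP; split => -[x v] /=.
  move=> H; split => [|i]; first by have := H 0; rewrite mxE unlift_none.
  by have := H (lift 0 i); rewrite mxE liftK.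
move=> [Ax Av] i; rewrite mxE; case: (unliftP 0 i) => [j ->|->] //=.
Qed.

End lebesgue_rV.

Section surface.
Context {R : realType}.

(* The library norm on 'rV[R]_n is the sup norm, hence a separate Euclidean norm;
   both induce the topology used for [compact] and [borel_rV]. *)
Definition enorm n (v : 'rV[R]_n) : R := Num.sqrt (\sum_(i < n) v 0 i ^+ 2).

Definition unit_sphere n : set 'rV[R]_n := [set u | enorm u = 1].

(* Surface measure on the unit sphere by the usual polar-coordinates construction
   (Folland, Real Analysis, Theorem 2.49): n times the volume of the truncated
   cone { r u | 0 < r <= 1, u in A }. *)
Definition sphere_measure n (A : set 'rV[R]_n) : \bar R :=
  (n%:R%:E * lebesgue_rV n
    [set r *: u | r in `]0%R, 1%R] & u in A `&` @unit_sphere n])%E.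

Definition sphere_area n : \bar R := sphere_measure (@unit_sphere n).

Lemma sphere_area1 : sphere_area 1 = 2%:E.
Proof.
rewrite /sphere_area /sphere_measure mul1e setIid.
have e1 (u : 'rV[R]_1) : enorm u = `|u 0 0|.
  by rewrite /enorm big_ord1 sqrtr_sqr.
pose A := (`[-1, 0[ `|` `]0, 1] : set R)%classic.
rewrite (_ : [set _ | _ in _ & _ in _] =
    [set v : 'rV[R]_1 | forall i, (fun=> A) i (v 0 i)]); last first.
  apply/seteqP; split => [_ [r + [u + <-]] i|v /(_ 0) Av].
    rewrite /= in_itv/= /unit_sphere/= e1 (ord1 i) mxE => /andP[r0 r1].
    rewrite /A /= !in_itv/=; case: (lerP 0 (u 0 0)) => u0.
      by rewrite ger0_norm// => ->; right; rewrite mulr1 r0.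
    rewrite ltr0_norm// => /eqP; rewrite eqr_oppLR => /eqP ->; left.
    by rewrite mulrN1 lerN2 r1 oppr_lt0.
  exists `|v 0 0|; last exists ((Num.sg (v 0 0))%:M).
  - case: Av; rewrite /= !in_itv/= => /andP[v1 v2].
      by rewrite ltr0_norm// oppr_gt0 v2 lerNl.
    by rewrite gtr0_norm// v1.
  - rewrite /unit_sphere/= e1 mxE eqxx mulr1n normr_sg.
    by case: Av; rewrite /= !in_itv/= => /andP[]; case: ltgtP.
  - apply/rowP => i; rewrite (ord1 i) !mxE eqxx mulr1n mulrC.
    by rewrite -numEsg.
have mA : measurable (A : set (measurableTypeR R)) by exact: measurableU.
rewrite (@lebesgue_rV_box R 1 (fun=> A))// big_ord1 /A measureU//=; last first.
  apply/seteqP; split => // x [] /=; rewrite !in_itv/= => /andP[_ x0] /andP[].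
  by rewrite ltNge (ltW x0).
rewrite !lebesgue_measure_itv/= !lte_fin ltrN10 ltr01 -!EFinB -EFinD.
by congr EFin; rewrite opprK add0r subr0.
Qed.

End surface.

Section riesz.
Context {R : realType}.

Definition riesz_kernel n (p : R) (x y : 'rV[R]_n) : \bar R :=
  if x == y then +oo%E else (enorm (x - y) `^ (- p))%:E.

Definition riesz_energy_of n (p : R) (K : set 'rV[R]_n)
    (mu : probability (borel_rV R n) R) : \bar R :=
  (\int[mu]_(x in K) \int[mu]_(y in K) riesz_kernel p x y)%E.

(* Probability measures on K are the Borel probability measures on R^n giving K
   full mass; for K = set0 there is none and the infimum is +oo. *)
Definition riesz_energy n (p : R) (K : set 'rV[R]_n) : \bar R :=
  ereal_inf [set riesz_energy_of p K mu |
    mu in [set mu : probability (borel_rV R n) R | mu K = 1%E]].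

(* The energy lies in (0, +oo], so the default branch only handles +oo, following
   the convention (+oo)^(-1/p) = 0. *)
Definition riesz_capacity n (p : R) (K : set 'rV[R]_n) : R :=
  if riesz_energy p K is v%:E then v `^ (- p^-1) else 0.

End riesz.

(* Main.v *)
Require Import Defs.
From HB Require Import structures.
From mathcomp Require Import all_boot all_order all_algebra.
From mathcomp Require Import all_classical all_reals all_analysis.
From mathcomp Require Import measurable_realfun ring lra.

Set Implicit Arguments.
Unset Strict Implicit.
Unset Printing Implicit Defensive.

Import Order.TTheory GRing.Theory Num.Theory.
Import numFieldNormedType.Exports.

Local Open Scope classical_set_scope.
Local Open Scope ring_scope.

(** Write S for n times the volume of the unit ball, which is what the area of the
    sphere amounts to, and V_p for the p-energy of K.  Since Cap_p^p = 1 / V_p,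
    the claim is that (n - p) V_p tends to S / m(K).  Everything comes from one
    blow-up rate: the integral of |y|^-p over the unit ball is exactly S / (n - p)
    ([integral_powRN_ball]), and all but a bounded part of it comes from an
    arbitrarily small ball, so that the potential of Lebesgue measure on a
    set L is S / (n - p) + O(1) at every point around which L contains a ball of
    fixed radius, and at most that everywhere.

    Upper bound for V_p.  When m(K) > 0, the uniform probability on K has
    potential at most (S / (n - p) + m(K)) / m(K) everywhere ([riesz_energy_le]).

    Lower bound for V_p.  An arbitrary probability P on K has to be handled, and
    the tool is positive definiteness of the kernel: the mutual energies satisfy
    2 I(P, U) <= I(P, P) + I(U, U) ([riesz_mutual_energy_le]).  Take for U the
    uniform probability on a neighbourhood L of K that contains a ball of fixed
    radius around each point of K.  Then I(P, U) and I(U, U) are respectively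
    at least and at most S / (m(L) (n - p)) up to bounded terms, whatever P is,
    hence (n - p) V_p >= S / m(L) - o(1) ([energy_ge]).  As K is compact, m(L)
    can be brought as close to m(K) as desired ([outer_neighborhood]).

    Positive definiteness itself is read off an explicit factorization
    ([riesz_kernel_factorization]): up to a constant, |x - y|^-p is the integral
    over the half-space of points (s, z), s > 0, of F_x F_y, where
      F_x(s, z) = s^(-(n + 1 + p) / 2) exp(-|x - z|^2 / (2 s^2)).
    Integrating in z leaves a Gaussian in |x - y| / s, and integrating in s then
    gives a power of |x - y| by homogeneity.  The value of the constant does not
    matter, only that it is positive and finite; the inequality for mutual
    energies is 2 a b <= a^2 + b^2 applied to the two potentials at each point of
    the half-space. *)

(** * Affine changes of variables in R^n *)

Section affine_change_of_variables.
Context {R : realType}.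
Local Notation leb := (@lebesgue_measure R).

Let measurable_affine (a s : R) : measurable_fun setT
  (fun x : measurableTypeR R => (a + s * x) : measurableTypeR R).
Proof. by apply: measurable_funD => //; apply: measurable_funM. Qed.

(** Uniqueness of Lebesgue measure on the line: the image measure scaled by s gives
    intervals the right length. *)
Lemma ge0_integral_affine (f : R -> \bar R) (a s : R) : 0 < s ->
  measurable_fun setT f -> (forall x, (0 <= f x)%E) ->
  (\int[leb]_x f x = s%:E * \int[leb]_x f (a + s * x)%R)%E.
Proof.
move=> s0 mf f0.
pose phi : measurableTypeR R -> measurableTypeR R := fun x => a + s * x.
have mphi : measurable_fun setT phi by exact: measurable_affine.
pose image_leb : {measure set (measurableTypeR R) -> \bar R} :=
  measure_function_pushforward__canonical__measure_function_Measure leb mphi.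
pose nu := mscale (NngNum (ltW s0)) image_leb.
have nuE A : measurable A -> leb A = nu A.
  apply: lebesgue_measure_unique => _ [[x y] _ <-].
  change (leb `]x, y]%classic = s%:E * leb (phi @^-1` `]x, y]%classic))%E.
  rewrite (_ : phi @^-1` _ = `](x - a) / s, (y - a) / s]%classic); last first.
    apply/seteqP; split => z /=;
      rewrite !in_itv/= ltr_pdivrMr// ler_pdivlMr// (mulrC z) ltrBlDl lerBrDl//.
  rewrite !lebesgue_measure_itv/= !lte_fin ltr_pM2r ?invr_gt0// ltrD2r.
  case: ifPn => _; last by rewrite mule0.
  rewrite -!EFinB -EFinM; congr EFin.
  by field; rewrite gt_eqF.
transitivity (\int[nu]_x f x)%E.
  by apply: eq_measure_integral => A mA _; exact: nuE.
by rewrite ge0_integral_mscale// (ge0_integral_pushforward mphi).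
Qed.

Lemma measurable_rV_cons n : measurable_fun setT (@rV_cons R n).
Proof.
apply: measurable_fun_rV => i; case: (unliftP 0 i) => [j ->|->].
  under eq_fun do rewrite mxE liftK/=.
  exact: (measurableT_comp (@measurable_coord_rV R n j)).
under eq_fun do rewrite mxE unlift_none/=.
exact: measurable_fst.
Qed.

(** Turns the recursive construction of the volume into an iterated integral, the
    basis of all inductions on the dimension below. *)
Lemma ge0_integral_rVS n (f : borel_rV R n.+1 -> \bar R) :
  measurable_fun setT f -> (forall x, (0 <= f x)%E) ->
  (\int[lebesgue_rV n.+1]_x f x =
   \int[leb]_x \int[lebesgue_rV n]_v f (rV_cons (x, v)))%E.
Proof.
move=> mf f0; rewrite lebesgue_rVS.
rewrite (ge0_integral_pushforward (@measurable_rV_cons n))//.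
rewrite fubini_tonelli1//; last by move=> z; exact: f0.
exact: (measurableT_comp mf (@measurable_rV_cons n)).
Qed.

Lemma measurable_affine_rV n (a : 'rV[R]_n) (s : R) :
  measurable_fun setT (fun v : borel_rV R n => (a + s *: v) : borel_rV R n).
Proof.
apply: measurable_fun_rV => i.
under eq_fun do rewrite !mxE.
by apply: measurable_funD => //; apply: measurable_funM => //; exact: measurable_coord_rV.
Qed.

(** Only translations and homotheties occur, so the one-dimensional case applied to
    each coordinate suffices and no determinant is involved. *)
Lemma ge0_integral_affine_rV n (f : borel_rV R n -> \bar R) (a : 'rV[R]_n) (s : R) :
  0 < s -> measurable_fun setT f -> (forall x, (0 <= f x)%E) ->
  (\int[lebesgue_rV n]_x f x =
   (s ^+ n)%:E * \int[lebesgue_rV n]_x f (a + s *: (x : 'rV[R]_n))%R)%E.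
Proof.
move=> s0; elim: n f a => [|n ih] f a mf f0.
  rewrite lebesgue_rV0 expr0 mul1e !integral_dirac// ?diracT ?mul1e.
    by congr f; apply/rowP; case.
  exact: (measurableT_comp mf (measurable_affine_rV _ _)).
have mfa : measurable_fun setT (fun x : borel_rV R n.+1 => f (a + s *: (x : 'rV[R]_n.+1))).
  exact: (measurableT_comp mf (measurable_affine_rV _ _)).
have mfc : measurable_fun setT (f \o @rV_cons R n).
  exact: (measurableT_comp mf (@measurable_rV_cons n)).
rewrite !ge0_integral_rVS//.
pose a' : 'rV[R]_n := \row_j a 0 (lift 0 j).
have aE x (v : 'rV[R]_n) : a + s *: (rV_cons (x, v) : 'rV[R]_n.+1) =
    rV_cons (a 0 0 + s * x, a' + s *: v).
  apply/rowP => i; rewrite !mxE; case: (unliftP 0 i) => [j ->|->].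
    by rewrite /= !mxE.
  by [].
pose g (x : R) := (\int[lebesgue_rV n]_v f (rV_cons (x, v)))%E.
have g0 x : (0 <= g x)%E by apply: integral_ge0 => v _; exact: f0.
have mg : measurable_fun setT g.
  by apply: (measurable_fun_fubini_tonelli_F (f \o @rV_cons R n)) => //= z; exact: f0.
have mfx y : measurable_fun setT (fun v : borel_rV R n => f (rV_cons (y, v))).
  exact: (measurableT_comp mfc (measurable_pair1 y)).
have gE (x : measurableTypeR R) : (g (a 0 0 + s * x)%R = (s ^+ n)%:E *
    \int[lebesgue_rV n]_v f (a + s *: (@rV_cons R n (x, v) : 'rV[R]_n.+1))%R)%E.
  rewrite /g (ih _ a')//.
  by congr (_ * _)%E; apply: eq_integral => v _; rewrite aE.
pose h := (fun x : borel_rV R n.+1 => f (a + s *: (x : 'rV[R]_n.+1))) \o @rV_cons R n.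
have h0 z : (0 <= h z)%E by exact: f0.
have mh : measurable_fun setT h by exact: (measurableT_comp mfa (@measurable_rV_cons n)).
rewrite (@ge0_integral_affine g (a 0 0) s)// exprS EFinM -muleA.
congr (_ * _)%E; rewrite -ge0_integralZl//; first last.
- by rewrite lee_fin exprn_ge0// ltW.
- by move=> x _; apply: integral_ge0 => v _; exact: f0.
- exact: (measurable_fun_fubini_tonelli_F h).
by apply: eq_integral => x _; rewrite gE.
Qed.

End affine_change_of_variables.

(** * Euclidean norm, balls and the area of the sphere *)

Section euclidean_norm.
Context {R : realType}.
Implicit Types n : nat.

Lemma enorm_ge0 n (v : 'rV[R]_n) : 0 <= enorm v.
Proof. exact: sqrtr_ge0. Qed.

Lemma sqr_enorm n (v : 'rV[R]_n) : enorm v ^+ 2 = \sum_(i < n) v 0 i ^+ 2.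
Proof. by rewrite sqr_sqrtr// sumr_ge0// => i _; exact: sqr_ge0. Qed.

Lemma enormZ n (s : R) (v : 'rV[R]_n) : 0 <= s -> enorm (s *: v) = s * enorm v.
Proof.
move=> s0; rewrite /enorm; under eq_bigr do rewrite mxE exprMn.
by rewrite -mulr_sumr sqrtrM ?sqr_ge0// sqrtr_sqr ger0_norm.
Qed.

Lemma enormN n (v : 'rV[R]_n) : enorm (- v) = enorm v.
Proof. by rewrite /enorm; under eq_bigr do rewrite mxE sqrrN. Qed.

Lemma enorm_distC n (x y : 'rV[R]_n) : enorm (x - y) = enorm (y - x).
Proof. by rewrite -enormN opprB. Qed.

Lemma enorm0 n : enorm (0 : 'rV[R]_n) = 0.
Proof. by rewrite -(scale0r 0) enormZ// mul0r. Qed.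

Lemma ler_coord_enorm n (v : 'rV[R]_n) i : `|v 0 i| <= enorm v.
Proof.
rewrite -sqrtr_sqr ler_wsqrtr// (bigD1 i)//= lerDl.
by apply: sumr_ge0 => j _; exact: sqr_ge0.
Qed.

Lemma enorm_eq0 n (v : 'rV[R]_n) : (enorm v == 0) = (v == 0).
Proof.
apply/eqP/eqP => [v0|->]; last exact: enorm0.
apply/rowP => i; rewrite mxE; apply/eqP; rewrite -normr_le0 -v0.
exact: ler_coord_enorm.
Qed.

Lemma enorm_gt0 n (v : 'rV[R]_n) : (0 < enorm v) = (v != 0).
Proof. by rewrite lt_def enorm_ge0 andbT enorm_eq0. Qed.

Lemma ler_norm_enorm n (v : 'rV[R]_n) : `|v| <= enorm v.
Proof.
rewrite (_ : `|v| = mx_norm v)// mx_normrE; apply: bigmax_le; first exact: enorm_ge0.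
by move=> [i j] _ /=; rewrite (ord1 i) ler_coord_enorm.
Qed.

Lemma measurable_enorm n :
  measurable_fun setT (fun v : borel_rV R n => enorm (v : 'rV[R]_n)).
Proof.
apply: (measurableT_comp (f := @Num.sqrt R)).
  by apply: continuous_measurable_fun; exact: sqrt_continuous.
apply: measurable_sum => i.
by apply: (measurableT_comp (exprn_measurable 2)); exact: measurable_coord_rV.
Qed.

Lemma measurable_sub_rV d (T : measurableType d) n (f g : T -> borel_rV R n) :
  measurable_fun setT f -> measurable_fun setT g ->
  measurable_fun setT (fun t => ((f t : 'rV[R]_n) - g t) : borel_rV R n).
Proof.
move=> mf mg; apply: measurable_fun_rV => i.
under eq_fun do rewrite !mxE.
by apply: measurable_funB; apply: (measurableT_comp (@measurable_coord_rV R n i)).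
Qed.

(** The centre is left out because the Riesz kernel is infinite there, and because
    the cone over the sphere that defines the surface measure omits it too. *)
Definition punctured_ball n (r : R) : set (borel_rV R n) :=
  [set v | 0 < enorm (v : 'rV[R]_n) <= r].
Arguments punctured_ball : clear implicits.

Lemma measurable_punctured_ball n r : measurable (punctured_ball n r).
Proof.
rewrite (_ : punctured_ball n r = (fun v => enorm (v : 'rV[R]_n)) @^-1` `]0, r]%classic).
  by rewrite -[X in measurable X]setTI; apply: measurable_enorm.
by apply/seteqP; split => v /=; rewrite in_itv.
Qed.

Lemma lebesgue_punctured_ball n r : 0 < r ->
  (lebesgue_rV n (punctured_ball n r) =
   (r ^+ n)%:E * lebesgue_rV n (punctured_ball n 1))%E.
Proof.
move=> r0.
have volE s : lebesgue_rV n (punctured_ball n s) =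
    (\int[lebesgue_rV n]_x (\1_(punctured_ball n s) x)%:E)%E.
  by rewrite integral_indic ?setIT//; exact: measurable_punctured_ball.
rewrite !volE (@ge0_integral_affine_rV _ _ _ 0 r)//; last first.
  by apply/measurable_EFinP; apply: measurable_indic; exact: measurable_punctured_ball.
have scaled (v : 'rV[R]_n) : punctured_ball n r (0 + r *: v) = punctured_ball n 1 v.
  rewrite /punctured_ball/= add0r enormZ ?(ltW r0)//.
  by rewrite pmulr_rgt0// ger_pMr.
congr (_ * _)%E; apply: eq_integral => v _; congr EFin; rewrite !indicE.
by congr (nat_of_bool _)%:R; apply/idP/idP; rewrite !inE scaled.
Qed.

(** The truncated cone over the whole sphere is the unit ball without its centre. *)
Lemma sphere_area_punctured_ball n :
  (sphere_area n = n%:R%:E * lebesgue_rV n (punctured_ball n 1) :> \bar R)%E.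
Proof.
rewrite /sphere_area /sphere_measure setIid; congr (_ * lebesgue_rV n _)%E.
apply/seteqP; split => [_ [r + [u u1 <-]]|v /= /andP[v0 v1]].
  rewrite /= in_itv/= => /andP[r0 r1].
  by rewrite /punctured_ball/= enormZ ?(ltW r0)// u1 mulr1 r0 r1.
exists (enorm v); first by rewrite /= in_itv/= v0 v1.
exists ((enorm v)^-1 *: v).
  by rewrite /unit_sphere/= enormZ ?invr_ge0 ?enorm_ge0// mulVf// gt_eqF.
by rewrite scalerA divff ?scale1r// gt_eqF.
Qed.

Lemma lebesgue_rV_cube n (a b : R) : a <= b ->
  lebesgue_rV n [set v : 'rV[R]_n | forall i, v 0 i \in `]a, b]] = ((b - a) ^+ n)%:E.
Proof.
move=> ab; have := @lebesgue_rV_box R n (fun=> `]a, b]%classic) (fun=> measurable_itv _).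
rewrite /= => ->; rewrite lebesgue_measure_itv/= lte_fin.
rewrite (_ : (if _ then _ else _) = (b - a)%:E); last first.
  by move: ab; rewrite le_eqVlt => /predU1P[->|->//]; rewrite ltxx subrr.
by rewrite prodEFin prodr_const card_ord.
Qed.

Lemma measurable_cube n (a b : R) :
  measurable ([set v | forall i, (v : 'rV[R]_n) 0 i \in `]a, b]] : set (borel_rV R n)).
Proof.
rewrite (_ : mkset _ = \bigcap_(i in [set: 'I_n])
    (fun v : borel_rV R n => (v : 'rV[R]_n) 0 i) @^-1` `]a, b]%classic).
  apply: fin_bigcap_measurable => // i _.
  by rewrite -[X in measurable X]setTI; apply: measurable_coord_rV.
by apply/seteqP; split => [v /= H i _|v /= H i]; [exact: H|exact: (H i I)].
Qed.

Lemma lebesgue_rV_set1 n (x : 'rV[R]_n) : (0 < n)%N ->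
  lebesgue_rV n [set x] = 0%E.
Proof.
move=> n0.
have -> : [set x] = [set v : 'rV[R]_n | forall i, [set x 0 i] (v 0 i)].
  by apply/seteqP; split => [v -> //|v /= xv]; apply/rowP.
rewrite (@lebesgue_rV_box R n (fun i => [set x 0 i])).
  rewrite (bigD1 (Ordinal n0))//= lebesgue_measure_set1 mul0e//.
by move=> i; exact: measurable_set1.
Qed.

Lemma lebesgue_rV_bounded_lty n (A : set (borel_rV R n)) (M : R) : measurable A ->
  (forall v, A v -> `|(v : 'rV[R]_n)| <= M) -> (lebesgue_rV n A < +oo)%E.
Proof.
move=> mA AM.
apply: (@le_lt_trans _ _ (lebesgue_rV n
    [set v : 'rV[R]_n | forall i, v 0 i \in `](- `|M| - 1), `|M|]])).
  apply: le_measure; rewrite ?inE//; first exact: measurable_cube.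
  move=> v /AM vM i; rewrite in_itv/=.
  have : `|(v : 'rV[R]_n) 0 i| <= `|M|.
    apply: le_trans (ler_norm M); apply: le_trans vM.
    rewrite (_ : `|v| = mx_norm (v : 'rV[R]_n))// mx_normrE.
    by apply/bigmax_geP; right => /=; exists (0, i).
  rewrite ler_norml => /andP[? ->]; rewrite andbT.
  by apply: lt_le_trans (_ : - `|M| <= _); rewrite // ltrBlDr ltrDl.
rewrite lebesgue_rV_cube ?ltry//.
by have := normr_ge0 M; lra.
Qed.

Lemma lebesgue_punctured_ball_lty n r : (lebesgue_rV n (punctured_ball n r) < +oo)%E.
Proof.
apply: (@lebesgue_rV_bounded_lty _ _ r); first exact: measurable_punctured_ball.
by move=> v /andP[_ vr]; exact: le_trans (ler_norm_enorm _) vr.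
Qed.

(** The cube of side 1/n in the positive orthant lies in the unit ball, since the
    squares of its coordinates are at most 1/n each. *)
Lemma lebesgue_punctured_ball_gt0 n : (0 < n)%N ->
  (0 < lebesgue_rV n (punctured_ball n 1))%E.
Proof.
move=> n0; have n0' : 0 < (n%:R)^-1 :> R by rewrite invr_gt0 ltr0n.
apply: (@lt_le_trans _ _ (lebesgue_rV n
    [set v : 'rV[R]_n | forall i, v 0 i \in `]0, n%:R^-1]])).
  by rewrite lebesgue_rV_cube ?(ltW n0')// lte_fin subr0 exprn_gt0.
apply: le_measure; rewrite ?inE//;
  [exact: measurable_cube|exact: measurable_punctured_ball|].
move=> v /= v1; have {}v1 i : 0 < v 0 i <= n%:R^-1 by have := v1 i; rewrite in_itv.
apply/andP; split.
  have /andP[vi _] := v1 (Ordinal n0).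
  by apply: lt_le_trans vi (le_trans (ler_norm _) (ler_coord_enorm _ _)).
rewrite -sqrtr1 ler_wsqrtr//.
apply: (@le_trans _ _ (\sum_(i < n) n%:R^-1)); last first.
  by rewrite sumr_const card_ord -[_ *+ n]mulr_natl divff// pnatr_eq0 -lt0n.
apply: ler_sum => i _; have /andP[vi0 vi] := v1 i.
apply: le_trans vi; rewrite expr2 ger_pMr//.
by apply: le_trans (andP (v1 i)).2 _; rewrite invf_le1 ?ltr0n// ler1n.
Qed.

End euclidean_norm.
Arguments punctured_ball {R} n r.

(** * Integral of a power of the norm over the unit ball *)

Section integral_of_powers.
Context {R : realType}.
Local Notation leb := (@lebesgue_measure R).

Lemma cvg_powRN_pinfty (c : R) : 0 < c -> u `^ (- c) @[u --> +oo] --> (0 : R).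
Proof.
move=> c0; apply/cvgr0Pnorm_le => e e0; near=> u.
have ue : (e `^ (c^-1))^-1 <= u by near: u; exact: nbhs_pinfty_ge.
have w0 : 0 < (e `^ c^-1)^-1 by rewrite invr_gt0 powR_gt0.
have u0 : 0 < u by exact: lt_le_trans ue.
rewrite ger0_norm ?powR_ge0// powRN invf_ple ?posrE ?powR_gt0//.
have -> : e^-1 = ((e `^ c^-1)^-1) `^ c.
  by rewrite -!powRN -powRrM mulNr mulVf ?gt_eqF// powR_inv1 ?ltW.
by apply: ge0_ler_powR; rewrite ?nnegrE ltW.
Unshelve. all: by end_near. Qed.

Lemma continuous_powR_gt0 (a x : R) : 0 < x -> {for x, continuous (fun u : R => u `^ a)}.
Proof.
move=> x0; apply: differentiable_continuous; apply/derivable1_diffP.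
by apply: derivable_powR; rewrite in_itv/= andbT.
Qed.

(** The antiderivative u^(1 - a) / (1 - a) vanishes at infinity. *)
Lemma integral_powRN_1y (a : R) : 1 < a ->
  (\int[leb]_(u in `[1%R, +oo[) (u `^ (- a))%:E = ((a - 1)^-1)%:E)%E.
Proof.
move=> a1; have a10 : 0 < a - 1 by rewrite subr_gt0.
pose F (u : R) := - (a - 1)^-1 * u `^ (- (a - 1)).
have cF (x : R) : 0 < x -> {for x, continuous F}.
  by move=> x0; apply: cvgM; [exact: cvg_cst|exact: continuous_powR_gt0].
have dF (x : R) : 0 < x -> derivable F x 1.
  move=> x0; apply: derivableM; first exact: derivable_cst.
  by apply: derivable_powR; rewrite in_itv/= andbT.
rewrite (@ge0_continuous_FTC2y _ _ F 1 0).
- by rewrite /F powR1 mulr1 -EFinB opprK add0r.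
- by move=> x _; exact: powR_ge0.
- apply: continuous_in_subspaceT => x; rewrite inE/= in_itv/= andbT => x1.
  by apply: continuous_powR_gt0; exact: lt_le_trans x1.
- rewrite -(mulr0 (- (a - 1)^-1)).
  by apply: cvgM; [exact: cvg_cst|exact: cvg_powRN_pinfty].
- by move=> x x1; apply: dF; exact: lt_trans x1.
- by apply: cvg_at_right_filter; exact: cF.
- move=> x; rewrite in_itv/= andbT => x1.
  have x0 : 0 < x by exact: lt_trans x1.
  rewrite derive1E deriveM//; last first.
    by apply: derivable_powR; rewrite in_itv/= andbT.
  rewrite derive_cst scaler0 addr0 -derive1E powR_derive1; last by rewrite in_itv/= x0.
  rewrite /GRing.scale/= mulrA mulrNN mulVf ?gt_eqF// mul1r; congr (_ `^ _); ring.
Qed.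

(** Superlevel sets of |v|^-p are balls: this gives their radius. *)
Lemma ler_powRN_swap (u x p : R) : 0 < u -> 0 < x -> 0 < p ->
  (u <= x `^ (- p)) = (x <= u `^ (- p^-1)).
Proof.
move=> u0 x0 p0; rewrite -ler_ln ?posrE ?powR_gt0// -[RHS]ler_ln ?posrE ?powR_gt0//.
by rewrite !ln_powR !mulNr [in RHS]lerNr ler_pdivrMl// mulrN.
Qed.

(** Write |v|^-p, which is at least 1 on the unit ball, as 1 plus the length of
    [1, |v|^-p], and exchange the integrals: the slice at height u >= 1 is the ball
    of radius u^(-1/p). *)
Lemma integral_powRN_ball_layer_cake n (p : R) : 0 < p ->
  (\int[lebesgue_rV n]_(v in punctured_ball n 1) (enorm (v : 'rV[R]_n) `^ (- p))%:E =
   lebesgue_rV n (punctured_ball n 1) +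
   \int[leb]_(u in `[1%R, +oo[) lebesgue_rV n (punctured_ball n (u `^ (- p^-1))))%E.
Proof.
move=> p0.
pose L : set (borel_rV R n * measurableTypeR R) :=
  [set z | [/\ 0 < enorm (z.1 : 'rV[R]_n), 1 <= z.2 &
               z.2 <= enorm (z.1 : 'rV[R]_n) `^ (- p)]].
have mB := @measurable_punctured_ball R n 1.
have men : measurable_fun setT (fun v : borel_rV R n => enorm (v : 'rV[R]_n)).
  exact: measurable_enorm.
have mpow : measurable_fun setT (fun v : borel_rV R n => enorm (v : 'rV[R]_n) `^ (- p)).
  by apply: (measurableT_comp (measurable_powR _)).
have mL : measurable L.
  have -> : L = ((fun z => enorm (z.1 : 'rV[R]_n)) @^-1` `]0, +oo[%classic `&`
     (fun z => z.2) @^-1` `[1, +oo[%classic) `&`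
     (fun z => enorm (z.1 : 'rV[R]_n) `^ (- p) - z.2) @^-1` `[0, +oo[%classic.
    apply/seteqP; split => z /=; rewrite !in_itv/= !andbT subr_ge0.
      by move=> [].
    by move=> [[]].
  apply: measurableI; first apply: measurableI.
  - rewrite -[X in measurable X]setTI.
    by apply: (measurableT_comp men measurable_fst).
  - rewrite -[X in measurable X]setTI.
    by apply: measurable_snd.
  - rewrite -[X in measurable X]setTI.
    have : measurable_fun setT
        (fun z : borel_rV R n * measurableTypeR R => enorm (z.1 : 'rV[R]_n) `^ (- p) - z.2).
      apply: measurable_funB; last exact: measurable_snd.
      exact: (measurableT_comp mpow measurable_fst).
    by apply.
have Lv (v : borel_rV R n) : (\int[leb]_u (\1_L (v, u))%:E =
   if v \in punctured_ball n 1 then (enorm (v : 'rV[R]_n) `^ (- p) - 1)%:E else 0)%E.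
  have E : (fun u => (\1_L (v, u))%:E : \bar R) = (fun u => (\1_(xsection L v) u)%:E).
    by apply/funext => u; congr EFin; rewrite !indicE mem_xsection.
  rewrite E integral_indic//; last exact: measurable_xsection.
  rewrite setIT; case: ifPn => [|]; rewrite ?inE ?notin_setE.
    move=> /andP[v0 v1].
    have -> : xsection L v = `[1, enorm (v : 'rV[R]_n) `^ (- p)]%classic.
      apply/seteqP; split => u; rewrite /xsection/= inE/= in_itv/= /L/=.
        by move=> [_ -> ->].
      by move=> /andP[? ?].
    have := lebesgue_measure_itv (`[1, enorm (v : 'rV[R]_n) `^ (- p)] : interval R).
    rewrite /= => ->; rewrite lte_fin -EFinB.
    case: ifPn => //.
    rewrite lt_neqAle negb_and negbK ler_powRN_swap// powR1 v1 orbF.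
    by move=> /eqP <-; rewrite subrr.
  move=> nv; rewrite (_ : xsection L v = set0) ?measure0//.
  apply/seteqP; split => u //; rewrite /xsection/= inE/= /L/= => -[v0 u1 uv].
  apply: nv; rewrite /punctured_ball/= v0/= leNgt; apply/negP => v1.
  by have := le_trans u1 uv; rewrite ler_powRN_swap// powR1 leNgt v1.
have Lu (u : R) : (\int[lebesgue_rV n]_v (\1_L (v, u))%:E =
   if u \in `[1%R, +oo[%classic
   then lebesgue_rV n (punctured_ball n (u `^ (- p^-1))) else 0)%E.
  have E : (fun v => (\1_L (v, u))%:E : \bar R) = (fun v => (\1_(ysection L u) v)%:E).
    by apply/funext => v; congr EFin; rewrite !indicE mem_ysection.
  rewrite E integral_indic//; last exact: measurable_ysection.
  rewrite setIT; case: ifPn => [|]; rewrite ?inE ?notin_setE/= in_itv/= andbT.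
    move=> u1; have u0 : 0 < u by exact: lt_le_trans u1.
    congr (lebesgue_rV n _); apply/seteqP; split => v; rewrite /ysection/= inE/= /L/=.
      by move=> [v0 _]; rewrite ler_powRN_swap// /punctured_ball/= v0.
    by move=> /andP[v0 vu]; split; rewrite // ler_powRN_swap.
  move=> nu; rewrite (_ : ysection L u = set0) ?measure0//.
  by apply/seteqP; split => v //; rewrite /ysection/= inE/= /L/= => -[].
transitivity (\int[lebesgue_rV n]_(v in punctured_ball n 1)
   (1 + \int[leb]_u (\1_L (v, u))%:E))%E.
  by apply: eq_integral => v vB; rewrite Lv vB -EFinD addrC subrK.
have mind : measurable_fun setT
    (fun z : borel_rV R n * measurableTypeR R => (\1_L z)%:E : \bar R).
  by apply/measurable_EFinP; apply: measurable_indic.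
have ind0 z : (0 <= (\1_L z)%:E :> \bar R)%E by rewrite lee_fin.
have mLv : measurable_fun setT (fun v => \int[leb]_u (\1_L (v, u))%:E)%E.
  exact: (measurable_fun_fubini_tonelli_F (fun z => (\1_L z)%:E)).
rewrite ge0_integralD//; first last.
- exact: measurable_funTS.
- by move=> v _; apply: integral_ge0 => u _; rewrite lee_fin.
rewrite integral_cst// mul1e; congr (_ + _)%E.
transitivity (\int[lebesgue_rV n]_v \int[leb]_u (\1_L (v, u))%:E)%E.
  rewrite integral_mkcond; apply: eq_integral => v _; rewrite /patch.
  by case: ifPn => // vB; rewrite Lv (negbTE vB).
rewrite (fubini_tonelli (fun z => (\1_L z)%:E))//.
rewrite [RHS]integral_mkcond; apply: eq_integral => u _.
by rewrite Lu /patch.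
Qed.

(** By homogeneity of the volume the layers contribute a multiple of the integral of
    u^(-n/p), which converges exactly when p < n. *)
Lemma integral_powRN_ball n (p : R) : 0 < p -> p < n%:R ->
  (\int[lebesgue_rV n]_(v in punctured_ball n 1) (enorm (v : 'rV[R]_n) `^ (- p))%:E =
   (n%:R / (n%:R - p))%:E * lebesgue_rV n (punctured_ball n 1))%E.
Proof.
move=> p0 pn; rewrite integral_powRN_ball_layer_cake//.
set w := lebesgue_rV n (punctured_ball n 1).
have w_fin : w \is a fin_num by rewrite ge0_fin_numE ?measure_ge0 ?lebesgue_punctured_ball_lty.
have np1 : 1 < n%:R / p by rewrite ltr_pdivlMr// mul1r.
under eq_integral => u.
  rewrite inE/= in_itv/= andbT => u1.
  have u0 : 0 < u by exact: lt_le_trans u1.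
  rewrite lebesgue_punctured_ball ?powR_gt0// -powR_mulrn ?powR_ge0// -powRrM.
  rewrite mulNr mulrC -/w.
  over.
rewrite ge0_integralZr//; first last.
- exact: measure_ge0.
- by move=> u _; rewrite lee_fin powR_ge0.
- apply/measurable_EFinP; apply: measurable_funTS; exact: measurable_powR.
rewrite integral_powRN_1y// -(fineK w_fin) -!EFinM -EFinD; congr EFin.
by field; rewrite !subr_eq0 !gt_eqF.
Qed.

End integral_of_powers.

(** * Mutual energies for a factorized kernel *)

Section mutual_energy.
Local Open Scope ereal_scope.
Context d d' (T : measurableType d) (W : measurableType d') (R : realType).
Variables (rho : {sigma_finite_measure set W -> \bar R}) (F : T -> W -> \bar R).
Hypothesis mF : measurable_fun setT (fun z : T * W => F z.1 z.2).
Hypothesis F0 : forall x w, 0 <= F x w.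

Definition potential (m : {measure set T -> \bar R}) w := \int[m]_x F x w.

Let mFx x : measurable_fun setT (F x).
Proof. apply: (measurableT_comp (f := fun z : T * W => F z.1 z.2) mF (measurable_pair1 x)). Qed.

Let mFw w : measurable_fun setT (F ^~ w).
Proof. apply: (measurableT_comp (f := fun z : T * W => F z.1 z.2) mF (measurable_pair2 w)). Qed.

Lemma potential_ge0 m w : 0 <= potential m w.
Proof. by apply: integral_ge0 => x _; exact: F0. Qed.

Lemma measurable_potential (m : {sigma_finite_measure set T -> \bar R}) :
  measurable_fun setT (potential m).
Proof. exact: (measurable_fun_fubini_tonelli_G (fun z => F z.1 z.2)). Qed.

(** Tonelli, twice: the mutual energy is a scalar product of potentials. *)
Lemma mutual_energyE (m1 m2 : {sigma_finite_measure set T -> \bar R}) :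
  \int[m1]_x \int[m2]_y \int[rho]_w (F x w * F y w) =
  \int[rho]_w (potential m1 w * potential m2 w).
Proof.
transitivity (\int[m1]_x \int[rho]_w (F x w * potential m2 w)).
  apply: eq_integral => x _.
  rewrite (fubini_tonelli (fun z : T * W => F x z.2 * F z.1 z.2))/=; first last.
  - by move=> z; exact: mule_ge0.
  - apply: emeasurable_funM => //.
    exact: (measurableT_comp (mFx x) measurable_snd).
  apply: eq_integral => w _; rewrite ge0_integralZl//.
rewrite (fubini_tonelli (fun z : T * W => F z.1 z.2 * potential m2 z.2))/=; first last.
- by move=> z; apply: mule_ge0 => //; exact: potential_ge0.
- apply: emeasurable_funM => //.
  exact: (measurableT_comp (measurable_potential m2) measurable_snd).
apply: eq_integral => w _; rewrite ge0_integralZr//; exact: potential_ge0.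
Qed.

Let mule_amgm (a b : \bar R) : 0 <= a -> 0 <= b -> a * b + a * b <= a * a + b * b.
Proof.
case: a => [a| |]; case: b => [b| |]//=.
- rewrite !lee_fin => a0 b0.
  rewrite -?EFinD ?lee_fin -subr_ge0.
  have -> : (a * a + b * b - (a * b + a * b) = (a - b) ^+ 2)%R by ring.
  by rewrite ?sqr_ge0.
- by move=> a0 b0; rewrite [X in _ <= _ + X]mulyy addey ?leey.
- by move=> a0 b0; rewrite [X in _ <= X + _]mulyy addye ?leey.
Qed.

(** Positive definiteness.  It is stated without subtraction because each of the
    energies may be infinite. *)
Lemma mutual_energy_le (m1 m2 : {sigma_finite_measure set T -> \bar R}) :
  \int[m1]_x \int[m2]_y \int[rho]_w (F x w * F y w) +
  \int[m1]_x \int[m2]_y \int[rho]_w (F x w * F y w) <=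
  \int[m1]_x \int[m1]_y \int[rho]_w (F x w * F y w) +
  \int[m2]_x \int[m2]_y \int[rho]_w (F x w * F y w).
Proof.
have U0 := potential_ge0; have mU := measurable_potential.
have mUU (m m' : {sigma_finite_measure set T -> \bar R}) :
  measurable_fun setT (fun w => potential m w * potential m' w).
  exact: emeasurable_funM.
rewrite !mutual_energyE -!ge0_integralD//; do ?by move=> w _; exact: mule_ge0.
apply: ge0_le_integral => //.
- by move=> w _; apply: adde_ge0; exact: mule_ge0.
- exact: emeasurable_funD.
- exact: emeasurable_funD.
- by move=> w _; exact: mule_amgm.
Qed.

End mutual_energy.

(** * Gaussians on the half-space *)

Section gaussian_factorization.
Context {R : realType}.
Local Notation leb := (@lebesgue_measure R).

Lemma enorm_rV_cons n (x : measurableTypeR R) (v : 'rV[R]_n) :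
  enorm (rV_cons (x, v) : 'rV[R]_n.+1) ^+ 2 = x ^+ 2 + enorm v ^+ 2.
Proof.
rewrite !sqr_enorm big_ord_recl; congr (_ + _); first by rewrite mxE unlift_none.
by apply: eq_bigr => i _; rewrite mxE liftK.
Qed.

Lemma measurable_gauss_rV n :
  measurable_fun setT (fun v : borel_rV R n => (expR (- enorm (v : 'rV[R]_n) ^+ 2))%:E).
Proof.
apply/measurable_EFinP; apply: (measurableT_comp measurable_gauss_fun).
exact: measurable_enorm.
Qed.

(** The Gaussian is a product over the coordinates.  What matters later is that its
    integral is positive and finite. *)
Lemma integral_gauss_rV n :
  (\int[lebesgue_rV n]_v (expR (- enorm (v : 'rV[R]_n) ^+ 2))%:E =
   (Num.sqrt pi ^+ n)%:E)%E.
Proof.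
elim: n => [|n ih].
  rewrite lebesgue_rV0 integral_dirac//; last exact: measurable_gauss_rV.
  by rewrite diracT mul1e enorm0 expr0n oppr0 expR0 expr0.
pose g (v : borel_rV R n) : \bar R := (expR (- enorm (v : 'rV[R]_n) ^+ 2))%:E.
have g0 v : (0 <= g v)%E by rewrite lee_fin expR_ge0.
have mg : measurable_fun setT g by exact: measurable_gauss_rV.
rewrite ge0_integral_rVS//; last exact: measurable_gauss_rV.
transitivity (\int[leb]_x ((gauss_fun x)%:E * (Num.sqrt pi ^+ n)%:E))%E.
  apply: eq_integral => x _; rewrite -ih -/g -ge0_integralZl//; last first.
    by rewrite lee_fin gauss_fun_ge0.
  by apply: eq_integral => v _; rewrite enorm_rV_cons opprD expRD EFinM.
rewrite ge0_integralZr//; first by rewrite integralT_gauss -EFinM exprS.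
- by apply/measurable_EFinP; exact: measurable_gauss_fun.
- by move=> x _; rewrite lee_fin gauss_fun_ge0.
Qed.

Variables (n : nat) (p : R).
Hypothesis p0 : 0 < p.

(** A point (s, z) of R x R^n is encoded as a vector of R^(n+1) whose first
    coordinate is s. *)
Definition rV_tail (w : borel_rV R n.+1) : borel_rV R n :=
  \row_j (w : 'rV[R]_n.+1) 0 (lift 0 j).

Lemma rV_tail_cons x v : rV_tail (rV_cons (x, v)) = v.
Proof. by apply/rowP => j; rewrite !mxE liftK. Qed.

Lemma rV_head_cons x v : (@rV_cons R n (x, v) : 'rV[R]_n.+1) 0 0 = x.
Proof. by rewrite mxE unlift_none. Qed.

(** The power of s is chosen so that, once the Gaussian integral over z has produced
    a factor s^n, the factor s^-(p + 1) remains, whose integral in s against a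
    function of |x - y| / s is homogeneous of degree -p in |x - y|.  The indicator
    restricts to the half-space s > 0, and powers with exponent -1 stand for
    inverses. *)
Definition gauss_factor (x : borel_rV R n) (w : borel_rV R n.+1) : \bar R :=
  let s := (w : 'rV[R]_n.+1) 0 0 in
  (\1_(`]0, +oo[%classic : set R) s * (s `^ (- ((n%:R + 1 + p) / 2)) *
    expR (- (enorm ((x : 'rV[R]_n) - rV_tail w) * s `^ (-1)) ^+ 2 / 2)))%:E.

Lemma gauss_factor_ge0 x w : (0 <= gauss_factor x w)%E.
Proof. by rewrite lee_fin !mulr_ge0// ?powR_ge0// expR_ge0. Qed.

Lemma measurable_gauss_factor : measurable_fun setT
  (fun z : borel_rV R n * borel_rV R n.+1 => gauss_factor z.1 z.2).
Proof.
have m1 : measurable_fun setT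
    (fun z : borel_rV R n * borel_rV R n.+1 => (z.2 : 'rV[R]_n.+1) 0 0).
  exact: (measurableT_comp (@measurable_coord_rV R n.+1 0) measurable_snd).
have mt : measurable_fun setT (fun z : borel_rV R n * borel_rV R n.+1 => rV_tail z.2).
  apply: measurable_fun_rV => j; under eq_fun do rewrite mxE.
  exact: (measurableT_comp (@measurable_coord_rV R n.+1 _) measurable_snd).
have mi : measurable_fun setT (\1_(`]0, +oo[%classic : set R) : R -> R).
  exact: measurable_indic.
have md : measurable_fun setT (fun z : borel_rV R n * borel_rV R n.+1 =>
    ((z.1 : 'rV[R]_n) - rV_tail z.2) : borel_rV R n).
  exact: measurable_sub_rV.
apply/measurable_EFinP; apply: measurable_funM.
  exact: (measurableT_comp mi m1).
apply: measurable_funM; first exact: (measurableT_comp (measurable_powR _) m1).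
apply: (measurableT_comp (@measurable_expR R)).
apply: measurable_funM => //.
apply: (measurableT_comp (f := -%R : R -> R)) => //.
apply: (measurableT_comp (exprn_measurable 2)).
apply: measurable_funM; last exact: (measurableT_comp (measurable_powR _) m1).
exact: (measurableT_comp (@measurable_enorm R n) md).
Qed.

End gaussian_factorization.

(** * Factorization of the Riesz kernel *)

Section riesz_kernel_factorization.
Context {R : realType}.
Local Notation leb := (@lebesgue_measure R).
Variables (n : nat) (p : R).
Hypothesis p0 : 0 < p.

(** Completing the square: as a function of z, the product of the Gaussians centred
    at x and y is a Gaussian centred at their midpoint. *)
Lemma enorm_parallelogram (x y z : 'rV[R]_n) :
  enorm (x - z) ^+ 2 + enorm (y - z) ^+ 2 =
  2 * enorm (z - 2^-1 *: (x + y)) ^+ 2 + enorm (x - y) ^+ 2 / 2.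
Proof.
rewrite !sqr_enorm -big_split mulr_sumr mulr_suml -big_split; apply: eq_bigr => i _ /=.
by rewrite !mxE; field.
Qed.

(** What remains of the product of two factors after integration over z, up to a
    constant, with r the distance between the two points. *)
Definition gauss_profile (r s : R) : R :=
  s `^ (- (p + 1)) * expR (- (r * s `^ (-1)) ^+ 2 / 4).

Lemma gauss_profile_ge0 r s : 0 <= gauss_profile r s.
Proof. by rewrite mulr_ge0 ?powR_ge0// expR_ge0. Qed.

Lemma measurable_gauss_profile r : measurable_fun setT (gauss_profile r).
Proof.
apply: measurable_funM; first exact: measurable_powR.
apply: (measurableT_comp (@measurable_expR R)).
apply: measurable_funM => //.
apply: (measurableT_comp (f := -%R : R -> R)) => //.
apply: (measurableT_comp (exprn_measurable 2)).
apply: measurable_funM => //; exact: measurable_powR.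
Qed.

Lemma integral_gauss_factor_gt0 (x y : 'rV[R]_n) (s : R) : 0 < s ->
  (\int[lebesgue_rV n]_z (gauss_factor p x (rV_cons (s, z)) * gauss_factor p y (rV_cons (s, z))) =
   (Num.sqrt pi ^+ n * gauss_profile (enorm (x - y)) s)%:E)%E.
Proof.
move=> s0.
pose f (z : borel_rV R n) := (gauss_factor p x (rV_cons (s, z)) * gauss_factor p y (rV_cons (s, z)))%E.
have mhf (u : 'rV[R]_n) :
    measurable_fun setT (fun z : borel_rV R n => gauss_factor p u (rV_cons (s, z))).
  have := measurableT_comp (@measurable_gauss_factor R n p)
    (measurable_pair1 (u : borel_rV R n)).
  move=> /measurableT_comp /(_ (@measurable_rV_cons R n)).
  by move=> /measurableT_comp /(_ (measurable_pair1 (s : measurableTypeR R))).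
have mf : measurable_fun setT f by exact: emeasurable_funM.
have f0 z : (0 <= f z)%E by apply: mule_ge0; exact: gauss_factor_ge0.
rewrite -/f (@ge0_integral_affine_rV R n f (2^-1 *: (x + y)) s)//.
pose c := s `^ (- (n%:R + 1 + p)) * expR (- (enorm (x - y) * s `^ (-1)) ^+ 2 / 4).
(* the substitution z = (x + y) / 2 + s v centres and normalizes the Gaussian *)
have fE (v : 'rV[R]_n) :
    f (2^-1 *: (x + y) + s *: v) = (c%:E * (expR (- enorm v ^+ 2))%:E)%E.
  rewrite /f /gauss_factor !rV_head_cons !rV_tail_cons -!EFinM; congr EFin => /=.
  rewrite indicE mem_set ?mul1r; last by rewrite /= in_itv/= s0.
  rewrite mulrACA -expRD -powRD; last by rewrite (gt_eqF s0) implybT.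
  rewrite /c -[RHS]mulrA -expRD; congr (_ `^ _ * expR _); first by field.
  set z := 2^-1 *: (x + y) + s *: v.
  have := enorm_parallelogram x y z.
  rewrite {3}/z addrAC subrr add0r enormZ ?(ltW s0)// => E.
  rewrite powR_inv1 ?(ltW s0)// !exprMn.
  rewrite -mulrDl -opprD -mulrDl E.
  by field; rewrite gt_eqF.
transitivity ((s ^+ n)%:E *
    \int[lebesgue_rV n]_v (c%:E * (expR (- enorm (v : 'rV[R]_n) ^+ 2))%:E))%E.
  by congr (_ * _)%E; apply: eq_integral => v _; exact: fE.
rewrite ge0_integralZl//; first last.
- by rewrite lee_fin mulr_ge0 ?powR_ge0// expR_ge0.
- exact: measurable_gauss_rV.
rewrite integral_gauss_rV -!EFinM; congr EFin.
rewrite /c /gauss_profile -powR_mulrn ?(ltW s0)//.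
have -> : s `^ (- (p + 1)) = s `^ n%:R * s `^ (- (n%:R + 1 + p)).
  rewrite -powRD; last by rewrite (gt_eqF s0) implybT.
  by congr (_ `^ _); ring.
ring.
Qed.

Lemma integral_gauss_factor (x y : 'rV[R]_n) :
  (\int[lebesgue_rV n.+1]_w (gauss_factor p x w * gauss_factor p y w) =
   (Num.sqrt pi ^+ n)%:E *
   \int[leb]_(s in `]0%R, +oo[) (gauss_profile (enorm (x - y)) s)%:E)%E.
Proof.
have mhf (u : 'rV[R]_n) : measurable_fun setT (gauss_factor p (u : borel_rV R n)).
  exact: (measurableT_comp (@measurable_gauss_factor R n p)
    (measurable_pair1 (u : borel_rV R n))).
rewrite ge0_integral_rVS//; first last.
- by move=> w; apply: mule_ge0; exact: gauss_factor_ge0.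
- exact: emeasurable_funM.
rewrite -ge0_integralZl//; first last.
- by move=> s _; rewrite lee_fin gauss_profile_ge0.
- by apply/measurable_EFinP; apply: measurable_funTS; exact: measurable_gauss_profile.
rewrite [RHS]integral_mkcond; apply: eq_integral => s _; rewrite /patch.
case: ifPn => [|]; rewrite ?notin_setE ?inE/= in_itv/= andbT => s0.
  by rewrite integral_gauss_factor_gt0// EFinM.
rewrite integral0_eq// => z _; rewrite /gauss_factor rV_head_cons indicE memNset ?mul0r ?mul0e//.
by rewrite /= in_itv/= andbT.
Qed.

Local Notation radial r := (\int[leb]_(s in `]0%R, +oo[) (gauss_profile r s)%:E)%E.

(** Homogeneity, by the substitution s = r t. *)
Lemma radial_scale (r : R) : 0 < r -> radial r = ((r `^ (- p))%:E * radial 1)%E.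
Proof.
move=> r0; rewrite integral_mkcond.
rewrite (@ge0_integral_affine _ _ 0 r)//; first last.
- by move=> s; rewrite /patch; case: ifPn => // _; rewrite lee_fin gauss_profile_ge0.
- apply: (measurable_restrictT _ _).1 => //; apply/measurable_EFinP.
  by apply: measurable_funTS; exact: measurable_gauss_profile.
transitivity (r%:E *
    \int[leb]_(s in `]0%R, +oo[) ((r `^ (- (p + 1)))%:E * (gauss_profile 1 s)%:E))%E.
  congr (_ * _)%E; rewrite [RHS]integral_mkcond; apply: eq_integral => s _.
  rewrite /patch add0r.
  have -> : (r * s \in `]0, +oo[%classic) = (s \in `]0, +oo[%classic).
    by apply/idP/idP; rewrite !inE/= !in_itv/= !andbT pmulr_rgt0.
  case: ifPn => //; rewrite inE/= in_itv/= andbT => s0.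
  rewrite -EFinM /gauss_profile; congr EFin.
  rewrite !powRM ?(ltW r0) ?(ltW s0)// [RHS]mulrA; congr (_ * expR _).
  rewrite !powR_inv1 ?(ltW r0) ?(ltW s0)//; field.
  by rewrite !gt_eqF.
rewrite ge0_integralZl//; first last.
- by rewrite lee_fin powR_ge0.
- by move=> s _; rewrite lee_fin gauss_profile_ge0.
- by apply/measurable_EFinP; apply: measurable_funTS; exact: measurable_gauss_profile.
rewrite muleA -EFinM; congr (_%:E * _)%E.
have -> : r `^ (- p) = r `^ (1 + - (p + 1)) by congr (_ `^ _); ring.
by rewrite powRD ?(gt_eqF r0) ?implybT// powRr1// ltW.
Qed.

(** On the diagonal s^-(p + 1) is not integrable at 0: on the interval (0, e] its
    integral is at least e^-p, and e is arbitrary.  This matches the infinite value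
    of the kernel. *)
Lemma radial0 : radial 0 = +oo%E.
Proof.
apply/eqyP => A A0.
(* chosen so that e^-p = A *)
pose e := A `^ (- p^-1).
have e0 : 0 < e by exact: powR_gt0.
apply: (@le_trans _ _ (\int[leb]_(s in `]0%R, e]) (e `^ (- (p + 1)))%:E)%E).
  rewrite integral_cst//; have := lebesgue_measure_itv (`]0, e] : interval R).
  rewrite /= => ->; rewrite lte_fin e0 -EFinB subr0 -EFinM lee_fin.
  rewrite -[X in _ * X](@powRr1 _ e) ?(ltW e0)// -powRD ?(gt_eqF e0) ?implybT//.
  rewrite /e -powRrM le_eqVlt; apply/orP; left; apply/eqP.
  rewrite -[LHS]powRr1 ?(ltW A0)//; congr (_ `^ _); field.
  by rewrite gt_eqF.
apply: (@le_trans _ _ (\int[leb]_(s in `]0%R, e]) (gauss_profile 0 s)%:E)%E).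
  apply: ge0_le_integral => //.
  - by move=> s _; rewrite lee_fin powR_ge0.
  - by apply/measurable_EFinP; apply: measurable_funTS; exact: measurable_gauss_profile.
  - move=> s; rewrite /= in_itv/= => /andP[s0 se]; rewrite lee_fin /gauss_profile.
    rewrite mul0r expr0n/= oppr0 mul0r expR0 mulr1 !powRN.
    rewrite lef_pV2 ?posrE ?powR_gt0// ge0_ler_powR ?nnegrE ?addr_ge0 ?(ltW p0)// ltW//.
apply: ge0_subset_integral => //.
- by apply/measurable_EFinP; apply: measurable_funTS; exact: measurable_gauss_profile.
- by move=> s _; rewrite lee_fin gauss_profile_ge0.
- by move=> s; rewrite /= !in_itv/= => /andP[-> _].
Qed.

(** For s >= 1 the Gaussian is at least exp(-1/4). *)
Lemma radial1_gt0 : (0 < radial 1)%E.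
Proof.
apply: (@lt_le_trans _ _
    (\int[leb]_(s in `[1%R, +oo[) ((expR (- 4^-1))%:E * (s `^ (- (p + 1)))%:E))%E).
  rewrite ge0_integralZl//; first last.
  - by move=> s _; rewrite lee_fin powR_ge0.
  - by apply/measurable_EFinP; apply: measurable_funTS; exact: measurable_powR.
  rewrite integral_powRN_1y ?ltrDr// -EFinM lte_fin mulr_gt0 ?expR_gt0//.
  by rewrite invr_gt0 addrK.
apply: (@le_trans _ _ (\int[leb]_(s in `[1%R, +oo[) (gauss_profile 1 s)%:E)%E).
  apply: ge0_le_integral => //.
  - by move=> s _; rewrite mule_ge0// lee_fin ?powR_ge0// expR_ge0.
  - apply: measurable_funeM.
    by apply/measurable_EFinP; apply: measurable_funTS; exact: measurable_powR.
  - by apply/measurable_EFinP; apply: measurable_funTS; exact: measurable_gauss_profile.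
  - move=> s; rewrite /= in_itv/= andbT => s1; rewrite -EFinM lee_fin /gauss_profile mulrC.
    rewrite ler_wpM2l ?powR_ge0// ler_expR mulNr lerN2 ler_pdivrMr// mulVf//.
    rewrite mul1r powR_inv1 ?(le_trans _ s1)// expr_le1//
      ?invf_le1 ?invr_ge0 ?(lt_le_trans _ s1) ?(le_trans _ s1)//.
apply: ge0_subset_integral => //.
- by apply/measurable_EFinP; apply: measurable_funTS; exact: measurable_gauss_profile.
- by move=> s _; rewrite lee_fin gauss_profile_ge0.
- by move=> s; rewrite /= !in_itv/= !andbT; exact: lt_le_trans.
Qed.

(** The tail is integrable because p > 0.  Near 0 the Gaussian beats the power: with
    u = 1/s one has (p + 1) ln u - u^2 / 4 <= (p + 1) u - u^2 / 4 <= (p + 1)^2. *)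
Lemma radial1_lty : (radial 1 < +oo)%E.
Proof.
have mh D : measurable_fun D (fun s => (gauss_profile 1 s)%:E).
  by apply/measurable_EFinP; apply: measurable_funTS; exact: measurable_gauss_profile.
have -> : `]0%R, +oo[%classic = `]0%R, 1[%classic `|` `[1%R, +oo[%classic :> set R.
  apply/seteqP; split => s /=; rewrite !in_itv/= !andbT.
    by move=> s0; case: (ltrP s 1); [left; rewrite s0|right].
  by move=> [/andP[]//|]; exact: lt_le_trans.
rewrite ge0_integral_setU//; first last.
- rewrite disj_set2E; apply/eqP; rewrite -subset0 => s [/=].
  by rewrite !in_itv/= andbT => /andP[_]; rewrite ltNge => /negP.
- by move=> s _; rewrite lee_fin gauss_profile_ge0.
- exact: mh.
apply: lte_add_pinfty.
  apply: (@le_lt_trans _ _ (\int[leb]_(s in `]0%R, 1%R[) (expR ((p + 1) ^+ 2))%:E)%E).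
    apply: ge0_le_integral => //.
    - by move=> s _; rewrite lee_fin gauss_profile_ge0.
    - exact: mh.
    - move=> s; rewrite /= in_itv/= => /andP[s0 s1]; rewrite lee_fin /gauss_profile.
      rewrite mul1r powR_inv1 ?(ltW s0)// /powR gt_eqF// -expRD ler_expR.
      have lns : - ln s <= s^-1.
        by rewrite -lnV ?posrE//; apply: ltW; apply: ln_sublinear; rewrite invr_gt0.
      have : (p + 1) * (- ln s) <= (p + 1) * s^-1 by rewrite ler_wpM2l// addr_ge0// ltW.
      have : 0 <= (p + 1 - s^-1 / 2) ^+ 2 by exact: sqr_ge0.
      set u := s^-1; set l := ln s; nra.
  rewrite integral_cst//; have := lebesgue_measure_itv (`]0, 1[ : interval R).
  by rewrite /= => ->; rewrite lte_fin ltr01 -EFinB -EFinM ltry.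
apply: (@le_lt_trans _ _ (\int[leb]_(s in `[1%R, +oo[) (s `^ (- (p + 1)))%:E)%E).
  apply: ge0_le_integral => //.
  - by move=> s _; rewrite lee_fin gauss_profile_ge0.
  - exact: mh.
  - by apply/measurable_EFinP; apply: measurable_funTS; exact: measurable_powR.
  - move=> s _; rewrite lee_fin /gauss_profile ler_piMr ?powR_ge0// -expR0 ler_expR.
    by rewrite mulNr oppr_le0 divr_ge0// sqr_ge0.
by rewrite integral_powRN_1y ?ltrDr// ltry.
Qed.

Lemma riesz_kernel_factorization : exists2 c : R, 0 < c &
  forall x y : 'rV[R]_n,
  (\int[lebesgue_rV n.+1]_w (gauss_factor p x w * gauss_factor p y w) =
   c%:E * riesz_kernel p x y)%E.
Proof.
have C_fin : radial 1 \is a fin_num by rewrite gt0_fin_numE ?radial1_gt0 ?radial1_lty.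
have C0 : 0 < fine (radial 1) by rewrite fine_gt0// radial1_gt0 radial1_lty.
have G0 : 0 < Num.sqrt (pi : R) ^+ n by rewrite exprn_gt0// sqrtr_gt0 pi_gt0.
exists (Num.sqrt pi ^+ n * fine (radial 1)); first exact: mulr_gt0.
move=> x y; rewrite integral_gauss_factor /riesz_kernel; case: eqVneq => [->|xy].
  rewrite subrr enorm0 radial0 !gt0_muley// ?lte_fin//; exact: mulr_gt0.
rewrite radial_scale ?enorm_gt0 ?subr_eq0// EFinM fineK//.
by rewrite -muleA (muleC (radial 1)).
Qed.

End riesz_kernel_factorization.

(** * Uniform probabilities *)

Section integral_on_full_set.
Local Open Scope ereal_scope.
Context d (T : measurableType d) (R : realType).

Lemma ge0_integral_full_set (m : {measure set T -> \bar R}) (D : set T) (f : T -> \bar R) :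
  measurable D -> m (~` D) = 0 -> measurable_fun setT f -> (forall x, 0 <= f x) ->
  \int[m]_(x in D) f x = \int[m]_x f x.
Proof.
move=> mD mD0 mf f0.
have mDc : measurable (~` D) by exact: measurableC.
rewrite -(setUv D) [RHS]ge0_integral_setU//; first last.
- by rewrite disj_set2E setICr.
- by rewrite setUv.
rewrite [X in _ = _ + X](_ : _ = 0) ?adde0//.
rewrite -(integral_measure_zero (~` D) f).
apply: eq_measure_integral => A mA AD; rewrite /mzero; apply/eqP.
rewrite -measure_le0 -mD0; by apply: le_measure; rewrite ?inE.
Qed.

End integral_on_full_set.

Section uniform_probability.
Context {R : realType} (n : nat).
Variables (L : set (borel_rV R n)) (mL : measurable L).
Local Notation vol := (lebesgue_rV n).

(** The Dirac mass is the value when the volume of L is 0 or infinite. *)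
Definition uniform_rV : probability (borel_rV R n) R :=
  mnormalize (mrestr vol mL) (@dirac _ (borel_rV R n) (0 : 'rV[R]_n) R).

Hypotheses (L0 : (0 < vol L)%E) (Loo : (vol L < +oo)%E).

Lemma uniform_rVE A : uniform_rV A = (vol (A `&` L) * (fine (vol L))^-1%:E)%E.
Proof.
rewrite /uniform_rV/= /mnormalize/= /mrestr setTI.
by rewrite gt_eqF// lt_eqF.
Qed.

Lemma uniform_rV_self : uniform_rV L = 1%E.
Proof.
rewrite uniform_rVE setIid -{1}(@fineK _ (vol L)) ?gt0_fin_numE// -EFinM divff//.
by rewrite gt_eqF// fine_gt0// L0.
Qed.

Lemma ge0_integral_uniform_rV (f : borel_rV R n -> \bar R) :
  measurable_fun setT f -> (forall x, (0 <= f x)%E) ->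
  (\int[uniform_rV]_x f x = (fine (vol L))^-1%:E * \int[vol]_(x in L) f x)%E.
Proof.
move=> mf f0.
have V0 : 0 <= (fine (vol L))^-1 by rewrite invr_ge0 fine_ge0.
transitivity (\int[mscale (NngNum V0) (mrestr vol mL)]_x f x)%E.
  apply: eq_measure_integral => A mA _.
  by apply: etrans (uniform_rVE A) _; exact: muleC.
rewrite ge0_integral_mscale//; congr (_ * _)%E.
rewrite -(@ge0_integral_full_set _ _ _ _ L)//; last by rewrite /= /mrestr setICl.
by apply: eq_measure_integral => A mA AL; rewrite /= /mrestr setIidl.
Qed.

End uniform_probability.

(** * Riesz potentials of Lebesgue measure *)

Section riesz_kernel_theory.
Context {R : realType} (n : nat) (p : R).
Hypothesis p0 : 0 < p.
Local Notation vol := (@lebesgue_rV R n).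
Local Notation rk := (@riesz_kernel R n p).

Lemma powRN_antitone (a b : R) : 0 < a -> a <= b -> b `^ (- p) <= a `^ (- p).
Proof.
move=> a0 ab; have b0 := lt_le_trans a0 ab.
rewrite !powRN lef_pV2 ?posrE ?powR_gt0// ge0_ler_powR ?nnegrE//; exact: ltW.
Qed.

Lemma riesz_kernel_ge0 x y : (0 <= rk x y)%E.
Proof. by rewrite /riesz_kernel; case: ifPn => // _; rewrite lee_fin powR_ge0. Qed.

Lemma riesz_kernel_neq x y : x != y -> rk x y = (enorm (x - y) `^ (- p))%:E.
Proof. by move=> xy; rewrite /riesz_kernel (negbTE xy). Qed.

Lemma measurable_riesz_kernel :
  measurable_fun setT (fun z : borel_rV R n * borel_rV R n => rk z.1 z.2).
Proof.
pose g (r : R) : \bar R := if r == 0 then +oo%E else (r `^ (- p))%:E.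
have mg : measurable_fun setT g.
  apply: measurable_fun_ifT => //.
    exact: measurable_fun_eqr.
  by apply/measurable_EFinP; exact: measurable_powR.
have E : (fun z : borel_rV R n * borel_rV R n => rk z.1 z.2) =
    g \o (fun z => enorm ((z.1 : 'rV[R]_n) - z.2)).
  by apply/funext => z /=; rewrite /riesz_kernel /g enorm_eq0 subr_eq0.
rewrite E; apply: (measurableT_comp mg).
apply: (measurableT_comp (@measurable_enorm R n)).
exact: measurable_sub_rV.
Qed.

Lemma measurable_riesz_kernelr (x : borel_rV R n) :
  measurable_fun setT (fun y : borel_rV R n => rk x y).
Proof.
exact: (measurableT_comp (f := fun z : borel_rV R n * borel_rV R n => rk z.1 z.2)
  measurable_riesz_kernel (measurable_pair1 x)).
Qed.

Lemma measurable_riesz_potential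
    (m : {sigma_finite_measure set (borel_rV R n) -> \bar R}) :
  measurable_fun setT (fun x : borel_rV R n => \int[m]_y rk x y)%E.
Proof.
apply: (measurable_fun_fubini_tonelli_F (fun z : borel_rV R n * borel_rV R n => rk z.1 z.2)).
- exact: measurable_riesz_kernel.
- by move=> z; exact: riesz_kernel_ge0.
Qed.

(** The factorization holds up to a positive constant, which cancels. *)
Lemma riesz_mutual_energy_le
    (m1 m2 : {sigma_finite_measure set (borel_rV R n) -> \bar R}) :
  (\int[m1]_x \int[m2]_y rk x y + \int[m1]_x \int[m2]_y rk x y <=
   \int[m1]_x \int[m1]_y rk x y + \int[m2]_x \int[m2]_y rk x y)%E.
Proof.
have [c c0 cE] := @riesz_kernel_factorization R n p p0.
have scale (m m' : {sigma_finite_measure set (borel_rV R n) -> \bar R}) :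
    (\int[m]_x \int[m']_y \int[@lebesgue_rV R n.+1]_w
       (gauss_factor p x w * gauss_factor p y w) =
     c%:E * \int[m]_x \int[m']_y rk x y)%E.
  rewrite -ge0_integralZl//; first last.
  - by rewrite lee_fin ltW.
  - by move=> x _; apply: integral_ge0 => y _; exact: riesz_kernel_ge0.
  - exact: measurable_riesz_potential.
  apply: eq_integral => x _; rewrite -ge0_integralZl//; first last.
  - by rewrite lee_fin ltW.
  - by move=> y _; exact: riesz_kernel_ge0.
  - exact: measurable_riesz_kernelr.
  by apply: eq_integral => y _; rewrite cE.
have E0 (m m' : {sigma_finite_measure set (borel_rV R n) -> \bar R}) :
    (0 <= \int[m]_x \int[m']_y rk x y)%E.
  by apply: integral_ge0 => x _; apply: integral_ge0 => y _; exact: riesz_kernel_ge0.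
have := mutual_energy_le (@lebesgue_rV R n.+1)
  (@measurable_gauss_factor R n p) (@gauss_factor_ge0 R n p) m1 m2.
rewrite !scale -!ge0_muleDr//.
by rewrite lee_pmul2l.
Qed.

Definition shifted_ball (x : 'rV[R]_n) (r : R) : set (borel_rV R n) :=
  [set y | punctured_ball n r ((y : 'rV[R]_n) - x)].

Lemma measurable_shifted_ball x r : measurable (shifted_ball x r).
Proof.
rewrite -[X in measurable X]setTI.
have : measurable_fun setT (fun y : borel_rV R n => ((y : 'rV[R]_n) - x) : borel_rV R n).
  by apply: measurable_sub_rV.
by apply => //; exact: measurable_punctured_ball.
Qed.

(** Volumes are integrals of indicators, hence translation invariant. *)
Lemma volume_shifted_ball x r : vol (shifted_ball x r) = vol (punctured_ball n r).
Proof.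
have mB := measurable_shifted_ball x r; have mP := @measurable_punctured_ball R n r.
have volE (A : set (borel_rV R n)) : measurable A -> vol A = (\int[vol]_y (\1_A y)%:E)%E.
  by move=> mA; rewrite integral_indic ?setIT.
rewrite !volE// (@ge0_integral_affine_rV _ _ _ x 1)//; last first.
  by apply/measurable_EFinP; exact: measurable_indic.
rewrite expr1n mul1e; apply: eq_integral => v _; congr EFin; rewrite !indicE scale1r.
congr (nat_of_bool _)%:R.
by apply/idP/idP; rewrite !inE /shifted_ball/= addrAC subrr add0r.
Qed.

Lemma measurable_set1_rV (x : 'rV[R]_n) : measurable ([set x] : set (borel_rV R n)).
Proof.
have -> : [set x] = (fun y : borel_rV R n => enorm ((y : 'rV[R]_n) - x)) @^-1` [set 0].
  by apply/seteqP; split => y /=; [move=> ->; rewrite subrr enorm0|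
    move=> /eqP; rewrite enorm_eq0 subr_eq0 => /eqP].
rewrite -[X in measurable X]setTI.
have : measurable_fun setT (fun y : borel_rV R n => enorm ((y : 'rV[R]_n) - x)).
  apply: (measurableT_comp (@measurable_enorm R n)).
  exact: measurable_sub_rV.
by apply.
Qed.

Lemma integral_riesz_kernel_ball x r :
  (\int[vol]_(y in shifted_ball x r) rk x y =
   \int[vol]_(v in punctured_ball n r) (enorm (v : 'rV[R]_n) `^ (- p))%:E)%E.
Proof.
rewrite integral_mkcond (@ge0_integral_affine_rV _ _ _ x 1)//; first last.
- by move=> y; rewrite /patch; case: ifPn => // _; exact: riesz_kernel_ge0.
- apply: (measurable_restrictT _ _).1; first exact: measurable_shifted_ball.
  by apply: measurable_funTS; exact: measurable_riesz_kernelr.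
rewrite expr1n mul1e [RHS]integral_mkcond; apply: eq_integral => v _; rewrite /patch scale1r.
have -> : (x + v \in shifted_ball x r) = ((v : borel_rV R n) \in punctured_ball n r).
  by apply/idP/idP; rewrite !inE /shifted_ball/= addrAC subrr add0r.
case: ifPn => //; rewrite inE /punctured_ball/= enorm_gt0 => /andP[v0 _].
rewrite riesz_kernel_neq ?opprD ?addNKr// 1?enormN//.
by rewrite -subr_eq0 opprD addNKr oppr_eq0.
Qed.

Hypothesis pn : p < n%:R.
Let n0 : (0 < n)%N.
Proof. by rewrite -(ltr_nat R); exact: lt_trans pn. Qed.

Definition ball_volume : R := fine (vol (punctured_ball n 1)).

Lemma ball_volumeE : vol (punctured_ball n 1) = ball_volume%:E.
Proof. by rewrite fineK// ge0_fin_numE ?measure_ge0 ?lebesgue_punctured_ball_lty. Qed.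

(** The integral of the kernel over the unit ball, the quantity that blows up as p
    tends to n. *)
Definition ball_potential : R := n%:R / (n%:R - p) * ball_volume.

Lemma integral_riesz_kernel_unit_ball x :
  (\int[vol]_(y in shifted_ball x 1) rk x y = ball_potential%:E)%E.
Proof. by rewrite integral_riesz_kernel_ball integral_powRN_ball// ball_volumeE -EFinM. Qed.

(** The kernel is at most 1 outside the unit ball around x, and x itself is a null
    set. *)
Lemma riesz_potential_le x (L : set (borel_rV R n)) : measurable L ->
  (\int[vol]_(y in L) rk x y <= ball_potential%:E + vol L)%E.
Proof.
move=> mL.
have mB := measurable_shifted_ball x 1.
have mX : measurable ([set x] : set (borel_rV R n)) by exact: measurable_set1_rV.
have mLX : measurable (L `\` [set x]) by exact: measurableD.
have mrk D : measurable_fun D (fun y : borel_rV R n => rk x y).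
  by apply: measurable_funTS; exact: measurable_riesz_kernelr.
pose near_part := (fun y : borel_rV R n => rk x y) \_ (shifted_ball x 1).
have mpatch D : measurable_fun D near_part.
  apply: measurable_funTS; apply: (measurable_restrictT _ _).1 => //.
have patch0 y : (0 <= near_part y)%E.
  by rewrite /near_part /patch; case: ifPn => // _; exact: riesz_kernel_ge0.
rewrite (@ge0_negligible_integral _ _ _ _ L [set x])//; first last.
- exact: lebesgue_rV_set1.
- by move=> y _; exact: riesz_kernel_ge0.
apply: (@le_trans _ _ (\int[vol]_(y in L `\` [set x]) (near_part y + 1))%E).
  apply: ge0_le_integral => //.
  - by move=> y _; exact: riesz_kernel_ge0.
  - by apply: emeasurable_funD.
  - move=> y [_ /= /eqP yx]; rewrite /near_part /patch; case: ifPn => [_|]; first by rewrite leeDl.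
    rewrite notin_setE /shifted_ball/= /punctured_ball/=.
    rewrite enorm_gt0 subr_eq0 yx/= => /negP.
    rewrite -ltNge => y1; rewrite add0e riesz_kernel_neq 1?eq_sym// lee_fin.
    by have := powRN_antitone ltr01 (ltW y1); rewrite powR1 enorm_distC.
rewrite ge0_integralD// integral_cst// mul1e leeD//; last first.
  by rewrite le_measure ?inE//; exact: subDsetl.
rewrite -(integral_riesz_kernel_unit_ball x) [leRHS]integral_mkcond.
exact: ge0_subset_integral.
Qed.

(** The kernel is at most d^-p on the part of the unit ball that lies outside the
    ball of radius d. *)
Lemma riesz_potential_ge x (d : R) (L : set (borel_rV R n)) : measurable L ->
  0 < d <= 1 -> shifted_ball x d `<=` L ->
  (ball_potential%:E <= \int[vol]_(y in L) rk x y + (d `^ (- p) * ball_volume)%:E)%E.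
Proof.
move=> mL /andP[d0 d1] dL.
have mrk D : measurable_fun D (fun y : borel_rV R n => rk x y).
  by apply: measurable_funTS; exact: measurable_riesz_kernelr.
have mB r := measurable_shifted_ball x r.
have dB : shifted_ball x d `<=` shifted_ball x 1.
  by move=> y /andP[y0 yd]; apply/andP; split => //; exact: le_trans d1.
rewrite -(integral_riesz_kernel_unit_ball x).
rewrite -[X in (\int[_]_(_ in X) _)%E](setDUK dB) ge0_integral_setU//; first last.
- by rewrite disj_set2E setDIK.
- by move=> y _; exact: riesz_kernel_ge0.
- exact: measurableD.
apply: leeD.
  by apply: ge0_subset_integral => // y _; exact: riesz_kernel_ge0.
apply: (@le_trans _ _
    (\int[vol]_(y in shifted_ball x 1 `\` shifted_ball x d) (d `^ (- p))%:E)%E).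
  apply: ge0_le_integral => //.
  - exact: measurableD.
  - by move=> y _; exact: riesz_kernel_ge0.
  - move=> y [/andP[y0 y1] /= yd].
    have {}yd : d < enorm ((y : 'rV[R]_n) - x).
      by rewrite ltNge; apply/negP => yd'; apply: yd; apply/andP.
    rewrite riesz_kernel_neq; last by rewrite eq_sym -subr_eq0 -enorm_gt0.
    by rewrite lee_fin enorm_distC powRN_antitone// ltW.
rewrite integral_cst; last exact: measurableD.
rewrite EFinM lee_wpmul2l ?lee_fin ?powR_ge0//.
apply: (@le_trans _ _ (vol (shifted_ball x 1))).
  by rewrite le_measure ?inE//; exact: measurableD.
by rewrite volume_shifted_ball ball_volumeE.
Qed.

End riesz_kernel_theory.

(** * Bounds for the energy *)

Section energy_bounds.
Context {R : realType} (n : nat) (p : R).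
Hypotheses (p0 : 0 < p) (pn : p < n%:R).
Local Notation vol := (@lebesgue_rV R n).
Local Notation rk := (@riesz_kernel R n p).
Local Notation J := (ball_potential n p).
Let n0 : (0 < n)%N.
Proof. by rewrite -(ltr_nat R); exact: lt_trans pn. Qed.

Let J0 : 0 <= J.
Proof.
rewrite mulr_ge0 ?divr_ge0 ?subr_ge0 ?(ltW pn)//.
by rewrite /ball_volume fine_ge0.
Qed.

(** Averages the uniform bound [riesz_potential_le], which does not depend on the
    point. *)
Lemma uniform_rV_energy_le (L : set (borel_rV R n)) (mL : measurable L) :
  (0 < vol L)%E -> (vol L < +oo)%E ->
  (\int[uniform_rV mL]_x \int[uniform_rV mL]_y rk x y <=
   ((fine (vol L))^-1 * (J + fine (vol L)))%:E)%E.
Proof.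
move=> L0 Loo; set M := fine (vol L).
have M0 : 0 < M by rewrite /M fine_gt0// L0.
have C0 : 0 <= M^-1 * (J + M) by rewrite mulr_ge0 ?invr_ge0 ?addr_ge0 ?(ltW M0).
apply: (@le_trans _ _ (\int[uniform_rV mL]_x (M^-1 * (J + M))%:E)%E); last first.
  by rewrite integral_cst// [X in (_ * X)%E](@probability_setT _ _ _ (uniform_rV mL)) mule1.
apply: ge0_le_integral => //.
- by move=> x _; apply: integral_ge0 => y _; exact: riesz_kernel_ge0.
- exact: measurable_riesz_potential.
move=> x _; rewrite ge0_integral_uniform_rV//; last by move=> y; exact: riesz_kernel_ge0.
  rewrite EFinM lee_wpmul2l ?lee_fin ?invr_ge0 ?(ltW M0)//.
  apply: le_trans (riesz_potential_le p0 pn _ mL) _.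
  by rewrite EFinD fineK// ge0_fin_numE ?measure_ge0.
exact: measurable_riesz_kernelr.
Qed.

(** The potential of the uniform probability on L is bounded below at each point of
    K, so its P-average is too, whatever P is.  The bounded error stays on the right
    so that only integrals of nonnegative functions are compared. *)
Lemma mutual_energy_uniform_rV_ge (P : probability (borel_rV R n) R)
    (K L : set (borel_rV R n)) (mL : measurable L) (d : R) :
  measurable K -> P K = 1%E -> 0 < d <= 1 ->
  (forall x, K x -> shifted_ball x d `<=` L) ->
  (0 < vol L)%E -> (vol L < +oo)%E ->
  (J%:E <= (fine (vol L))%:E * (\int[P]_x \int[uniform_rV mL]_y rk x y) +
    (d `^ (- p) * ball_volume n)%:E)%E.
Proof.
move=> mK PK d01 KL L0 Loo; set M := fine (vol L).
have M0 : 0 < M by rewrite /M fine_gt0// L0.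
have b0 : 0 <= d `^ (- p) * ball_volume n :> R.
  by rewrite mulr_ge0 ?powR_ge0// /ball_volume fine_ge0.
have mU := measurable_riesz_potential p (uniform_rV mL).
have U0 x : (0 <= \int[uniform_rV mL]_y rk x y)%E.
  by apply: integral_ge0 => y _; exact: riesz_kernel_ge0.
have PKc : P (~` K) = 0%E by rewrite probability_setC// PK subee.
rewrite -(@ge0_integral_full_set _ _ _ P K _ mK PKc mU U0).
rewrite -[leLHS]mule1 -PK -integral_cst//.
have -> : (d `^ (- p) * ball_volume n)%:E =
    (\int[P]_(x in K) (d `^ (- p) * ball_volume n)%:E)%E.
  by rewrite integral_cst// [X in (_ * X)%E]PK mule1.
have mUK : measurable_fun K
    (fun x : borel_rV R n => (M%:E * \int[uniform_rV mL]_y rk x y)%E).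
  by apply: measurable_funeM; exact: measurable_funTS.
rewrite -ge0_integralZl//; first last.
- exact: ltW.
- exact: measurable_funTS.
have MU0 x : K x -> (0 <= M%:E * \int[uniform_rV mL]_y rk x y)%E.
  by move=> _; apply: mule_ge0 => //; rewrite lee_fin ltW.
rewrite -ge0_integralD//.
apply: ge0_le_integral => //.
- exact: emeasurable_funD.
move=> x Kx; apply: le_trans (riesz_potential_ge p0 pn mL d01 (KL x Kx)) _.
apply: leeD => //.
rewrite ge0_integral_uniform_rV//; first last.
- by move=> y; exact: riesz_kernel_ge0.
- exact: measurable_riesz_kernelr.
by rewrite muleA -EFinM divff ?gt_eqF// mul1e.
Qed.

(** Combines 2 I(P, U) <= I(P, P) + I(U, U), for U uniform on L, with the two
    preceding bounds. *)
Lemma energy_ge (P : probability (borel_rV R n) R)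
    (K L : set (borel_rV R n)) (d : R) :
  measurable K -> measurable L -> P K = 1%E -> 0 < d <= 1 ->
  (forall x, K x -> shifted_ball x d `<=` L) ->
  (0 < vol L)%E -> (vol L < +oo)%E ->
  (((J - 2 * (d `^ (- p) * ball_volume n)) / fine (vol L) - 1)%:E <=
   \int[P]_x \int[P]_y rk x y)%E.
Proof.
move=> mK mL PK d01 KL L0 Loo.
have M0 : 0 < fine (vol L) by rewrite fine_gt0// L0.
have := mutual_energy_uniform_rV_ge mL mK PK d01 KL L0 Loo.
have := uniform_rV_energy_le mL L0 Loo.
have := riesz_mutual_energy_le p0 P (uniform_rV mL).
have E0 (m1 m2 : probability (borel_rV R n) R) :
    (0 <= \int[m1]_x \int[m2]_y rk x y)%E.
  by apply: integral_ge0 => x _; apply: integral_ge0 => y _; exact: riesz_kernel_ge0.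
have := E0 P P; have := E0 P (uniform_rV mL); have := E0 (uniform_rV mL) (uniform_rV mL).
set b := d `^ (- p) * ball_volume n; set M := fine (vol L) in M0 *.
move: (\int[P]_x \int[P]_y rk x y)%E (\int[P]_x \int[uniform_rV mL]_y rk x y)%E
  (\int[uniform_rV mL]_x \int[uniform_rV mL]_y rk x y)%E.
move=> [e| |] [u| |] [v| |] //=; rewrite ?leey//.
rewrite -?EFinM -?EFinD !lee_fin => v0 u0 e0 uev vle Jle.
rewrite lerBlDr ler_pdivrMr//.
have : v * M <= J + M by move: vle; rewrite mulrC ler_pdivlMr.
nra.
Qed.

Lemma riesz_energy_ofE (K : set (borel_rV R n)) (P : probability (borel_rV R n) R) :
  measurable K -> P K = 1%E ->
  riesz_energy_of p K P = (\int[P]_x \int[P]_y rk x y)%E.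
Proof.
move=> mK PK.
have PKc : P (~` K) = 0%E by rewrite probability_setC// PK subee.
have inner x : (\int[P]_(y in K) rk x y = \int[P]_y rk x y)%E.
  rewrite ge0_integral_full_set//; last by move=> y; exact: riesz_kernel_ge0.
  exact: measurable_riesz_kernelr.
rewrite /riesz_energy_of; transitivity (\int[P]_(x in K) \int[P]_y rk x y)%E.
  by apply: eq_integral => x _; exact: inner.
rewrite ge0_integral_full_set//; first exact: measurable_riesz_potential.
by move=> x; apply: integral_ge0 => y _; exact: riesz_kernel_ge0.
Qed.

Lemma riesz_energy_le (K : set (borel_rV R n)) : measurable K ->
  (0 < vol K)%E -> (vol K < +oo)%E ->
  (riesz_energy p K <= ((fine (vol K))^-1 * (J + fine (vol K)))%:E)%E.
Proof.
move=> mK K0 Koo.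
apply: le_trans (uniform_rV_energy_le mK K0 Koo).
rewrite -(riesz_energy_ofE mK (uniform_rV_self mK K0 Koo)).
apply: ereal_inf_lbound; exists (uniform_rV mK) => //=.
exact: uniform_rV_self.
Qed.

Lemma riesz_energy_ge (K L : set (borel_rV R n)) (d : R) :
  measurable K -> measurable L -> 0 < d <= 1 ->
  (forall x, K x -> shifted_ball x d `<=` L) ->
  (0 < vol L)%E -> (vol L < +oo)%E ->
  (((J - 2 * (d `^ (- p) * ball_volume n)) / fine (vol L) - 1)%:E <= riesz_energy p K)%E.
Proof.
move=> mK mL d01 KL L0 Loo; apply: le_ereal_inf_tmp => _ [P /= PK <-].
by rewrite (riesz_energy_ofE mK PK); exact: (energy_ge mK mL PK d01 KL).
Qed.

End energy_bounds.

(** * Neighbourhoods of a compact set *)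

Section thickening.
Context {R : realType} (n : nat).
Local Notation vol := (@lebesgue_rV R n).
Implicit Types K : set 'rV[R]_n.

Lemma open_measurable_rV (U : set 'rV[R]_n) : open U -> measurable (U : set (borel_rV R n)).
Proof. exact: sub_sigma_algebra. Qed.

Lemma compact_measurable_rV K : compact K -> measurable (K : set (borel_rV R n)).
Proof.
move=> cK; rewrite -[K]setCK; apply: measurableC; apply: open_measurable_rV.
by apply: closed_openC; apply: compact_closed => //; exact: norm_hausdorff.
Qed.

Lemma compact_norm_le K : compact K -> exists M : R, forall x, K x -> `|x| <= M.
Proof.
move=> /compact_bounded[M [_ KM]]; exists (M + 1) => x Kx.
by apply: KM => //; rewrite ltrDl.
Qed.

Lemma compact_lebesgue_rV_lty K : compact K -> (vol K < +oo)%E.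
Proof.
move=> cK; have [M KM] := compact_norm_le cK.
exact: (@lebesgue_rV_bounded_lty _ _ _ M (compact_measurable_rV cK)).
Qed.

(** Defined with the sup norm, whose balls generate the topology; being smaller
    than the Euclidean norm, it makes the neighbourhood contain Euclidean balls of
    smaller radius. *)
Definition thickening K (d : R) : set (borel_rV R n) :=
  [set y | exists2 x, K x & `|(y : 'rV[R]_n) - x| < d].

Lemma measurable_thickening K d : measurable (thickening K d).
Proof.
apply: open_measurable_rV.
have -> : (thickening K d : set 'rV[R]_n) = \bigcup_(x in K) ball x d.
  apply/seteqP; split => y [x Kx].
    by move=> yx; exists x => //; rewrite -ball_normE /ball_/= distrC.
  by rewrite -ball_normE /ball_/= => xy; exists x; rewrite // distrC.
by apply: bigcup_open => x _; exact: ball_open.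
Qed.

Lemma thickening_bounded K d : compact K -> exists M : R,
  forall y, thickening K d y -> `|(y : 'rV[R]_n)| <= M.
Proof.
move=> cK; have [M KM] := compact_norm_le cK; exists (d + M) => y [x Kx yx].
rewrite -(subrK x (y : 'rV[R]_n)); apply: le_trans (ler_normD _ _) _.
by apply: lerD; [exact: ltW|exact: KM].
Qed.

(** Continuity from above of the volume: a compact set is closed, hence the
    intersection of its neighbourhoods. *)
Lemma thickening_cvg K : compact K ->
  vol (thickening K k.+1%:R^-1) @[k --> \oo] --> vol K.
Proof.
move=> cK; set F := fun k : nat => thickening K k.+1%:R^-1.
have FK : \bigcap_k F k = K.
  apply/seteqP; split => [y Fy|x Kx k _]; last first.
    by exists x => //; rewrite subrr normr0 invr_gt0 ltr0n.
  have : closure K y.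
    move=> B /nbhs_ballP[e /= e0 yB].
    have [k _ /(_ k (leqnn k))/= ke] := near_infty_natSinv_lt (PosNum e0).
    have [x Kx yx] := Fy k I; exists x; split => //; apply: yB.
    by rewrite -ball_normE /ball_/=; exact: lt_trans ke.
  by apply: (compact_closed (@norm_hausdorff _ _) cK).
rewrite -[X in _ --> vol X]FK; apply: nonincreasing_cvg_mu.
- have [M FM] := thickening_bounded 1 cK.
  rewrite /F invr1; apply: (@lebesgue_rV_bounded_lty _ _ _ M) => //.
  exact: measurable_thickening.
- by move=> k; exact: measurable_thickening.
- by rewrite FK; exact: compact_measurable_rV.
- move=> k l kl; apply/subsetPset => y [x Kx yx]; exists x => //.
  by apply: lt_le_trans yx _; rewrite lef_pV2 ?posrE ?ltr0n// ler_nat.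
Qed.

(** Halving the radius of the thickening turns closed Euclidean balls around points of
    K into subsets of it. *)
Lemma outer_neighborhood K (e : R) : compact K -> 0 < e ->
  exists (L : set (borel_rV R n)) (d : R),
    [/\ measurable L, 0 < d <= 1, forall x, K x -> shifted_ball x d `<=` L,
        (vol L < +oo)%E & fine (vol L) < fine (vol K) + e].
Proof.
move=> cK e0.
have Kfin : vol K \is a fin_num.
  by rewrite ge0_fin_numE ?measure_ge0 ?compact_lebesgue_rV_lty.
have /fine_cvgP[_ /cvgr_lt] :
    vol (thickening K k.+1%:R^-1) @[k --> \oo] --> (fine (vol K))%:E.
  by rewrite fineK//; exact: thickening_cvg.
move=> /(_ (fine (vol K) + e)); rewrite ltrDl => /(_ e0)[k _ /(_ k (leqnn k))/= kK].
have k0 : 0 < k.+1%:R^-1 :> R by rewrite invr_gt0 ltr0n.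
exists (thickening K k.+1%:R^-1), (k.+1%:R^-1 / 2); split => //.
- exact: measurable_thickening.
- rewrite divr_gt0//= ler_pdivrMr// mul1r.
  by apply: (@le_trans _ _ 1); rewrite ?invf_le1 ?ltr0n ?ler1n ?ler1n.
- move=> x Kx y /andP[_ yx]; exists x => //.
  apply: le_lt_trans (ler_norm_enorm _) _; apply: le_lt_trans yx _.
  by rewrite ltr_pdivrMr// ltr_pMr// ltr1n.
- have [M FM] := thickening_bounded k.+1%:R^-1 cK.
  apply: (@lebesgue_rV_bounded_lty _ _ _ M) => //.
  exact: measurable_thickening.
Qed.

End thickening.

(** * The limit of the capacity *)

Section capacity_limit.
Context {R : realType} (n : nat).
Hypothesis n0 : (0 < n)%N.
Local Notation vol := (@lebesgue_rV R n).
Local Notation area := (n%:R * ball_volume n : R).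
Local Notation ratio K p := (riesz_capacity p K `^ p / (n%:R - p)).

Lemma area_gt0 : 0 < area.
Proof.
rewrite mulr_gt0 ?ltr0n// /ball_volume fine_gt0//.
by rewrite lebesgue_punctured_ball_gt0// lebesgue_punctured_ball_lty.
Qed.

(** Here and in the next lemma Cap_p^p = 1 / V_p; infinite energy means capacity 0. *)
Lemma riesz_capacity_powR_le (p a : R) (K : set 'rV[R]_n) : 0 < p -> 0 < a ->
  (a%:E <= riesz_energy p K)%E -> riesz_capacity p K `^ p <= a^-1.
Proof.
move=> p0 a0; rewrite /riesz_capacity; case: (riesz_energy p K) => [v| |]//=.
  rewrite lee_fin => av; have v0 := lt_le_trans a0 av.
  rewrite -powRrM mulNr mulVf ?gt_eqF// powR_inv1 ?(ltW v0)//.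
  by rewrite lef_pV2.
by move=> _; rewrite powR0 ?gt_eqF// invr_ge0 ltW.
Qed.

Lemma riesz_capacity_powR_ge (p b : R) (K : set 'rV[R]_n) : 0 < p ->
  (0 < riesz_energy p K)%E -> (riesz_energy p K <= b%:E)%E ->
  b^-1 <= riesz_capacity p K `^ p.
Proof.
move=> p0; rewrite /riesz_capacity; case: (riesz_energy p K) => [v| |]//=.
rewrite lte_fin lee_fin => v0 vb; have b0 := lt_le_trans v0 vb.
rewrite -powRrM mulNr mulVf ?gt_eqF// powR_inv1 ?(ltW v0)//.
by rewrite lef_pV2.
Qed.

Lemma riesz_energy_set0 (p : R) : riesz_energy p (set0 : set 'rV[R]_n) = +oo%E.
Proof.
rewrite /riesz_energy (_ : [set _ | _ in _] = set0) ?ereal_inf0//.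
apply/seteqP; split => // _ [P /= P0 _]; move: P0; rewrite measure0 => /eqP.
by rewrite eq_sym onee_eq0.
Qed.

Let cvg_left (g : R -> R) (l : R) : {for n%:R, continuous g} -> g n%:R = l ->
  g p @[p --> n%:R^'-] --> l.
Proof. by move=> cg <-; exact: cvg_at_left_filter. Qed.

(* The lower bound for the energy multiplied by n - p.  In this form it is a
   continuous function of p at n, with value S / M. *)
Let scaled_energy (M d p : R) :=
  (area - 2 * (n%:R - p) * (d `^ (- p) * ball_volume n)) / M - (n%:R - p).

Let cvg_scaled_energy (M d : R) : 0 < d ->
  scaled_energy M d p @[p --> n%:R^'-] --> area / M.
Proof.
move=> d0; apply: cvg_left; last first.
  by rewrite /scaled_energy subrr mulr0 mul0r !subr0.
have cpow : {for n%:R, continuous (fun p : R => d `^ (- p))}.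
  rewrite /powR gt_eqF//.
  apply: (@continuous_comp _ _ _ (fun p : R => - p * ln d) (@expR R)).
    by apply: cvgM; [apply: cvgN; exact: cvg_id|exact: cvg_cst].
  exact: continuous_expR.
have cs : {for n%:R, continuous (fun p : R => n%:R - p)}.
  by apply: cvgB; [exact: cvg_cst|exact: cvg_id].
apply: cvgB => //; apply: cvgM; last exact: cvg_cst.
apply: cvgB; first exact: cvg_cst.
apply: cvgM; last by apply: cvgM => //; exact: cvg_cst.
by apply: cvgM => //; exact: cvg_cst.
Qed.

Let near_left_gt0 : \forall p \near n%:R^'-, 0 < p :> R.
Proof. by apply: nbhs_left_gt; rewrite ltr0n. Qed.

Let near_left_lt : \forall p \near n%:R^'-, p < n%:R :> R.
Proof. exact: nbhs_left_lt. Qed.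

Let scaled_energy_le (K : set 'rV[R]_n) (L : set (borel_rV R n)) (d p : R) :
  compact K -> measurable L -> 0 < d <= 1 ->
  (forall x, K x -> shifted_ball x d `<=` L) ->
  (0 < vol L)%E -> (vol L < +oo)%E -> 0 < p -> p < n%:R ->
  ((scaled_energy (fine (vol L)) d p / (n%:R - p))%:E <= riesz_energy p K)%E.
Proof.
move=> cK mL d01 KL L0 Loo p0 pn.
have M0 : 0 < fine (vol L) by rewrite fine_gt0// L0.
have := riesz_energy_ge p0 pn (compact_measurable_rV cK) mL d01 KL L0 Loo.
apply: le_trans; rewrite lee_fin /scaled_energy /ball_potential le_eqVlt; apply/orP; left.
by apply/eqP; field; rewrite subr_eq0 !gt_eqF.
Qed.

Let near_ratio_le (K : set 'rV[R]_n) (e : R) : compact K -> K !=set0 -> 0 < e ->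
  (\forall p \near n%:R^'-, (0 < riesz_energy p K)%E) /\
  (\forall p \near n%:R^'-, ratio K p <= fine (vol K) / area + e).
Proof.
move=> cK [x0 Kx0] e0; have A0 := area_gt0.
have eA : 0 < e * area by exact: mulr_gt0.
(* m(L) / S < m(K) / S + e *)
have [L [d [mL d01 KL Loo Le]]] := outer_neighborhood cK eA.
have /andP[d0 d1] := d01.
have L0 : (0 < vol L)%E.
  apply: (@lt_le_trans _ _ (vol (shifted_ball x0 d))).
    rewrite volume_shifted_ball lebesgue_punctured_ball//.
    by rewrite mule_gt0 ?lebesgue_punctured_ball_gt0// lte_fin exprn_gt0.
  by rewrite le_measure ?inE//; [exact: measurable_shifted_ball|exact: KL].
have M0 : 0 < fine (vol L) by rewrite fine_gt0// L0.
have AM0 : 0 < area / fine (vol L) by exact: divr_gt0.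
have cE := @cvg_scaled_energy (fine (vol L)) d d0.
have nearE : \forall p \near n%:R^'-, 0 < scaled_energy (fine (vol L)) d p.
  exact: cvgr_gt cE _ AM0.
have bound p : 0 < p -> p < n%:R ->
    ((scaled_energy (fine (vol L)) d p / (n%:R - p))%:E <= riesz_energy p K)%E.
  by move=> p0 pn; exact: scaled_energy_le.
split.
  near=> p.
  have p0 : 0 < p by near: p.
  have pn : p < n%:R by near: p.
  have Ep : 0 < scaled_energy (fine (vol L)) d p by near: p.
  have np0 : 0 < n%:R - p by rewrite subr_gt0.
  have Eq0 := divr_gt0 Ep np0.
  apply: lt_le_trans (bound p p0 pn).
  by rewrite lte_fin.
have cV : (scaled_energy (fine (vol L)) d p)^-1 @[p --> n%:R^'-] -->
    (area / fine (vol L))^-1.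
  by apply: cvgV => //; rewrite gt_eqF.
have lim_lt : (area / fine (vol L))^-1 < fine (vol K) / area + e.
  by rewrite invf_div ltr_pdivrMr// mulrDl divfK ?gt_eqF//.
have nearV : \forall p \near n%:R^'-,
    (scaled_energy (fine (vol L)) d p)^-1 < fine (vol K) / area + e.
  exact: cvgr_lt cV _ lim_lt.
near=> p.
have p0 : 0 < p by near: p.
have pn : p < n%:R by near: p.
have Ep : 0 < scaled_energy (fine (vol L)) d p by near: p.
have Vp : (scaled_energy (fine (vol L)) d p)^-1 < fine (vol K) / area + e by near: p.
have np0 : 0 < n%:R - p by rewrite subr_gt0.
apply: le_trans (ltW Vp); rewrite ler_pdivrMr//.
have := riesz_capacity_powR_le p0 (divr_gt0 Ep np0) (bound p p0 pn).
by rewrite invf_div mulrC.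
Unshelve. all: by end_near. Qed.

Let near_ratio_ge (K : set 'rV[R]_n) (e : R) : compact K -> 0 < e ->
  \forall p \near n%:R^'-, fine (vol K) / area - e <= ratio K p.
Proof.
move=> cK e0; have A0 := area_gt0.
have Koo := compact_lebesgue_rV_lty cK; have mK := compact_measurable_rV cK.
have := measure_ge0 vol K; rewrite le_eqVlt => /predU1P[K0|K0].
  near=> p.
  have pn : p < n%:R by near: p.
  rewrite -K0 mul0r sub0r; apply: (@le_trans _ _ 0); first by rewrite oppr_le0 ltW.
  by rewrite divr_ge0 ?powR_ge0// subr_ge0 ltW.
have K1 : K !=set0.
  by apply/set0P/negP => /eqP KE; move: K0; rewrite KE measure0 ltxx.
have m0 : 0 < fine (vol K) by rewrite fine_gt0// K0.
(* the inverse of n - p times the upper bound for the energy *)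
pose h (p : R) := fine (vol K) / (area + (n%:R - p) * fine (vol K)).
have ch : h p @[p --> n%:R^'-] --> fine (vol K) / area.
  apply: cvg_left; last by rewrite /h subrr mul0r addr0.
  apply: cvgM; first exact: cvg_cst.
  apply: cvgV; first by rewrite subrr mul0r addr0 gt_eqF.
  apply: cvgD; first exact: cvg_cst.
  by apply: cvgM; [apply: cvgB; [exact: cvg_cst|exact: cvg_id]|exact: cvg_cst].
have lt_lim : fine (vol K) / area - e < fine (vol K) / area by rewrite ltrBlDr ltrDl.
have nearh : \forall p \near n%:R^'-, fine (vol K) / area - e < h p.
  exact: cvgr_gt ch _ lt_lim.
have [nearE _] := near_ratio_le cK K1 e0.
near=> p.
have p0 : 0 < p by near: p.
have pn : p < n%:R by near: p.
have Ep : (0 < riesz_energy p K)%E by near: p.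
have hp : fine (vol K) / area - e < h p by near: p.
have np0 : 0 < n%:R - p by rewrite subr_gt0.
apply: le_trans (ltW hp) _; rewrite ler_pdivlMr//.
apply: le_trans (riesz_capacity_powR_ge p0 Ep (riesz_energy_le p0 pn mK K0 Koo)).
rewrite /h /ball_potential le_eqVlt; apply/orP; left; apply/eqP; field.
have D0 : 0 < area + fine (vol K) * (n%:R - p).
  by rewrite addr_gt0// mulr_gt0.
by rewrite !gt_eqF.
Unshelve. all: by end_near. Qed.

(** The two one-sided estimates squeeze the ratio.  The empty set has infinite energy,
    hence ratio 0. *)
Lemma cvg_capacity_ratio (K : set 'rV[R]_n) : compact K ->
  ratio K p @[p --> n%:R^'-] --> fine (vol K) / area.
Proof.
move=> cK; apply/cvgrPdist_le => e e0.
have nearge := near_ratio_ge cK e0.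
have nearle : \forall p \near n%:R^'-, ratio K p <= fine (vol K) / area + e.
  have [K0|/set0P K1] := eqVneq K set0; last by case: (near_ratio_le cK K1 e0).
  near=> p.
  have p0 : 0 < p by near: p.
  rewrite K0 measure0 mul0r add0r /riesz_capacity riesz_energy_set0.
  by rewrite powR0 ?gt_eqF// mul0r ltW.
near=> p; rewrite distrC ler_distl; apply/andP; split; near: p => //.
Unshelve. all: by end_near. Qed.

End capacity_limit.

Theorem corollary1p2 (R : realType) (n : nat) (hn : (1 <= n)%N)
    (K : set 'rV[R]_n) (hK : compact K) :
  let f (p : R) := riesz_capacity p K `^ p / (n%:R - p) in
  cvg (f p @[p --> n%:R^'-]) /\
  lebesgue_rV n K = (sphere_area n * (lim (f p @[p --> n%:R^'-]))%:E)%E.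
Proof.
move=> f; have fK := cvg_capacity_ratio hn hK.
have A0 := @area_gt0 R n hn.
split; first by apply/cvg_ex; eexists; exact: fK.
rewrite (cvg_lim _ fK)//.
rewrite sphere_area_punctured_ball ball_volumeE -!EFinM.
rewrite mulrC divfK ?gt_eqF// fineK// ge0_fin_numE ?measure_ge0//.
exact: compact_lebesgue_rV_lty.
Qed.
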